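(* The total number of inequivalent integral holonomy representations occurring in generalized Hantzsche-Wendt Bieberbach groups of dimension $n$ equals $n/2$ for $n$ even and $(n+1)/2$ for $n$ odd.
   Context: A Bieberbach group of dimension $n$ is a torsion-free, discrete, cocompact subgroup $\Gamma$ of $\mathrm{E}(n)=\mathrm{O}(n)\ltimes\mathbb{R}^n$, the group of rigid motions of $\mathbb{R}^n$ with product $(B,b)(C,c)=(BC,Bc+b)$. Its translation subgroup $\Lambda\cong\mathbb{Z}^n$ is normal of finite index, and $G=\Gamma/\Lambda$ is its holonomy group. The integral holonomy representation of $\Gamma$ is the (faithful) representation $G\to\mathrm{Aut}(\Lambda)\cong\mathrm{GL}(n,\mathbb{Z})$ given by conjugation in $\Gamma$, i.e. $(B,b)$ acts by $\lambda\mapsto B\lambda$. The group $\Gamma$ is a generalized Hantzsche-Wendt (GHW) group if $G\cong\mathbb{Z}_2^{\,n-1}$. Two integral holonomy representations are considered equivalent if their images are conjugate subgroups of $\mathrm{GL}(n,\mathbb{Z})$, i.e. if they agree up to an isomorphism of the holonomy groups and a change of $\mathbb{Z}$-basis. *)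

(* Defs.v *)
From HB Require Import structures.
From mathcomp Require Import all_boot all_order all_algebra.
From mathcomp Require Import all_classical all_reals all_analysis.
Set Implicit Arguments.
Unset Strict Implicit.
Unset Printing Implicit Defensive.
Import Order.TTheory GRing.Theory Num.Theory numFieldNormedType.Exports.

Local Open Scope ring_scope.
Local Open Scope classical_set_scope.

Section Subgroup.
Variables (G : groupType) (H : groupClosed G).

Record subgroup := Subgroup { subgroup_val : G; _ : subgroup_val \in H }.

HB.instance Definition _ := [isSub for subgroup_val].
HB.instance Definition _ := [Choice of subgroup by <:].

Lemma groupClosed_group_closed : group_closed H.
Proof.
by split=> [|x y Hx Hy]; [exact: gpred1 | apply: gpredM => //; rewrite gpredV].
Qed.

HB.instance Definition _ :=
  SubChoice_isSubGroup.Build G (fun x => x \in H) subgroup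
    groupClosed_group_closed.

End Subgroup.

HB.mixin Record isConjClosed (G : groupType) (S : {pred G}) := {
  gpred_normal : forall x y : G, x \in S -> (x ^ y)%g \in S
}.

#[short(type="normalClosed")]
HB.structure Definition NormalClosed (G : groupType) :=
  {S of GroupClosed G S & isConjClosed G S}.

Section Coset.
Variables (G : groupType) (H : groupClosed G).

Definition coset_rel : rel G := fun x y => (x^-1 * y)%g \in H.

Lemma coset_rel_refl : reflexive coset_rel.
Proof. by move=> x; rewrite /coset_rel mulVg gpred1. Qed.

Lemma coset_rel_sym : symmetric coset_rel.
Proof. by move=> x y; rewrite /coset_rel -gpredV invgM invgK. Qed.

Lemma coset_rel_trans : transitive coset_rel.
Proof.
move=> y x z xy yz.
by rewrite /coset_rel -[z](mulVKg y) mulgA; apply: gpredM.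
Qed.

Canonical coset_equiv :=
  EquivRel coset_rel coset_rel_refl coset_rel_sym coset_rel_trans.

(* The left cosets x H. *)
Definition cosets := {eq_quot coset_equiv}%qT.

End Coset.

Section QuotientGroup.
Variables (G : groupType) (N : normalClosed G).

Definition quotient_group := cosets N.

HB.instance Definition _ := Choice.on quotient_group.
HB.instance Definition _ := EqQuotient.on quotient_group.

Local Open Scope quotient_scope.
Local Notation Q := quotient_group.

Lemma quotient_groupP (x y : G) :
  reflect (\pi_Q x = \pi_Q y) ((x^-1 * y)%g \in N).
Proof. exact: (@eqmodP _ (coset_equiv N) x y). Qed.

Definition quotient_mul := lift_op2 Q (fun x y : G => (x * y)%g).
Definition quotient_inv := lift_op1 Q (fun x : G => (x^-1)%g).
Definition quotient_one := \pi_Q (1%g : G).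

Fact pi_quotient_mul :
  {morph \pi_Q : x y / (x * y)%g >-> quotient_mul x y}.
Proof.
move=> x y; unlock quotient_mul; apply/quotient_groupP.
have /quotient_groupP xN := esym (reprK (\pi_Q x)).
have /quotient_groupP yN := esym (reprK (\pi_Q y)).
set x' := repr _ in xN *; set y' := repr _ in yN *.
have -> : ((x * y)^-1 * (x' * y') = (x^-1 * x') ^ y * (y^-1 * y'))%g.
  by rewrite conjgE invgM !mulgA mulgK.
by apply: gpredM => //; apply: gpred_normal.
Qed.

Fact pi_quotient_inv : {morph \pi_Q : x / (x^-1)%g >-> quotient_inv x}.
Proof.
move=> x; unlock quotient_inv; apply/quotient_groupP.
have /quotient_groupP xN := esym (reprK (\pi_Q x)).
set x' := repr _ in xN *.
have -> : (x^-1^-1 * x'^-1 = ((x^-1 * x')^-1) ^ x^-1)%g.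
  by rewrite conjgE invgM !invgK !mulgA mulgK.
by apply: gpred_normal; rewrite gpredV.
Qed.

Fact quotient_mulA : associative quotient_mul.
Proof.
by elim/quotW=> x; elim/quotW=> y; elim/quotW=> z;
  rewrite -!pi_quotient_mul mulgA.
Qed.

Fact quotient_mul1 : left_id quotient_one quotient_mul.
Proof. by elim/quotW=> x; rewrite -pi_quotient_mul mul1g. Qed.

Fact quotient_1mul : right_id quotient_one quotient_mul.
Proof. by elim/quotW=> x; rewrite -pi_quotient_mul mulg1. Qed.

Fact quotient_mulV : left_inverse quotient_one quotient_inv quotient_mul.
Proof.
by elim/quotW=> x; rewrite -pi_quotient_inv -pi_quotient_mul mulVg.
Qed.

Fact quotient_Vmul : right_inverse quotient_one quotient_inv quotient_mul.
Proof.
by elim/quotW=> x; rewrite -pi_quotient_inv -pi_quotient_mul mulgV.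
Qed.

HB.instance Definition _ := isGroup.Build quotient_group
  quotient_mulA quotient_mul1 quotient_1mul quotient_mulV quotient_Vmul.

End QuotientGroup.

Section Euclid.
Variables (R : realType) (n : nat).

Definition orthogonal_mx (B : 'M[R]_n) := B *m B^T == 1%:M.

(* [(B, b)] is the motion x |-> B x + b. *)
Record euclid := Euclid {
  euclid_val :> 'M[R]_n * 'cV[R]_n;
  _ : orthogonal_mx euclid_val.1 }.

HB.instance Definition _ := [isSub for euclid_val].
HB.instance Definition _ := [Choice of euclid by <:].
HB.instance Definition _ :=
  Topological.copy euclid (initial_topology euclid_val).

Definition linear_part (g : euclid) : 'M[R]_n := (euclid_val g).1.
Definition trans_part (g : euclid) : 'cV[R]_n := (euclid_val g).2.

Lemma linear_partP (g : euclid) : linear_part g *m (linear_part g)^T = 1%:M.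
Proof. by apply/eqP; case: g. Qed.

Lemma linear_partVP (g : euclid) : (linear_part g)^T *m linear_part g = 1%:M.
Proof. exact: mulmx1C (linear_partP g). Qed.

Lemma euclid_eq (g h : euclid) :
  linear_part g = linear_part h -> trans_part g = trans_part h -> g = h.
Proof.
by rewrite /linear_part /trans_part => e1 e2; apply/val_inj;
  rewrite /= [LHS]surjective_pairing e1 e2 -surjective_pairing.
Qed.

Fact euclid_one_subproof : orthogonal_mx (1%:M, 0 : 'cV[R]_n).1.
Proof. by rewrite /orthogonal_mx /= trmx1 mulmx1. Qed.
Definition euclid_one := Euclid euclid_one_subproof.

Fact euclid_mul_subproof (g h : euclid) :
  orthogonal_mx (linear_part g *m linear_part h,
                 linear_part g *m trans_part h + trans_part g).1.
Proof.
rewrite /orthogonal_mx /= trmx_mul mulmxA -(mulmxA _ (linear_part h)).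
by rewrite linear_partP mulmx1 linear_partP.
Qed.
Definition euclid_mul g h := Euclid (euclid_mul_subproof g h).

Fact euclid_inv_subproof (g : euclid) :
  orthogonal_mx ((linear_part g)^T, - ((linear_part g)^T *m trans_part g)).1.
Proof. by rewrite /orthogonal_mx /= trmxK linear_partVP. Qed.
Definition euclid_inv g := Euclid (euclid_inv_subproof g).

Fact euclid_mulA : associative euclid_mul.
Proof.
move=> g h k; apply: euclid_eq; rewrite /linear_part /trans_part /=.
  by rewrite mulmxA.
by rewrite mulmxDr mulmxA addrA.
Qed.

Fact euclid_mul1 : left_id euclid_one euclid_mul.
Proof.
by move=> g; apply: euclid_eq; rewrite /linear_part /trans_part /= mul1mx ?addr0.
Qed.

Fact euclid_1mul : right_id euclid_one euclid_mul.
Proof.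
move=> g; apply: euclid_eq; rewrite /linear_part /trans_part /=.
  by rewrite mulmx1.
by rewrite mulmx0 add0r.
Qed.

Fact euclid_mulV : left_inverse euclid_one euclid_inv euclid_mul.
Proof.
move=> g; apply: euclid_eq; first exact: linear_partVP.
by rewrite /linear_part /trans_part /= subrr.
Qed.

Fact euclid_Vmul : right_inverse euclid_one euclid_inv euclid_mul.
Proof.
move=> g; apply: euclid_eq; first exact: linear_partP.
rewrite /trans_part /= mulmxN mulmxA linear_partP mul1mx addrC.
exact: subrr.
Qed.

HB.instance Definition _ := isGroup.Build euclid
  euclid_mulA euclid_mul1 euclid_1mul euclid_mulV euclid_Vmul.

Lemma linear_partM (g h : euclid) :
  linear_part (g * h)%g = linear_part g *m linear_part h.
Proof. by []. Qed.

Lemma trans_partM (g h : euclid) :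
  trans_part (g * h)%g = linear_part g *m trans_part h + trans_part g.
Proof. by []. Qed.

Lemma linear_part1 : linear_part 1%g = 1%:M.
Proof. by []. Qed.

Lemma linear_partV (g : euclid) : linear_part g^-1%g = (linear_part g)^T.
Proof. by []. Qed.

Fact translation_subproof (v : 'cV[R]_n) : orthogonal_mx (1%:M, v).1.
Proof. exact: euclid_one_subproof. Qed.
Definition translation v := Euclid (translation_subproof v).

End Euclid.

Section Bieberbach.
Variables (R : realType) (n : nat) (Gamma : groupClosed (euclid R n)).

Definition torsion_free :=
  forall (g : euclid R n) (k : nat),
    g \in Gamma -> (0 < k)%N -> (g ^+ k)%g = 1%g -> g = 1%g.

Definition discrete_subgroup :=
  forall g : euclid R n, g \in Gamma -> isolated [set` Gamma] g.

Definition cocompact := compact [set: quotient_topology (cosets Gamma)].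

Definition bieberbach := [/\ torsion_free, discrete_subgroup & cocompact].

Definition translations : {pred subgroup Gamma} :=
  fun g => linear_part (val g) == 1%:M.

Fact translationsM : mulg_closed translations.
Proof.
move=> g h /eqP gT /eqP hT.
by rewrite unfold_in /translations valM linear_partM gT hT mulmx1.
Qed.

Fact translations1 : 1%g \in translations.
Proof. by rewrite unfold_in /translations val1 linear_part1. Qed.

Fact translationsV : invg_closed translations.
Proof.
move=> g /eqP gT.
by rewrite unfold_in /translations gmulfV linear_partV gT trmx1.
Qed.

Fact translationsJ (g h : subgroup Gamma) :
  g \in translations -> (g ^ h)%g \in translations.
Proof.
move=> /eqP gT; rewrite unfold_in /translations !valM gmulfV.
by rewrite !linear_partM gT mul1mx linear_partV linear_partVP.
Qed.

HB.instance Definition _ :=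
  isMulClosed.Build (subgroup Gamma) translations translationsM.
HB.instance Definition _ :=
  isMul1Closed.Build (subgroup Gamma) translations translations1.
HB.instance Definition _ :=
  isInvClosed.Build (subgroup Gamma) translations translationsV.
HB.instance Definition _ :=
  isConjClosed.Build (subgroup Gamma) translations translationsJ.

Definition holonomy : groupType := quotient_group (translations : normalClosed _).

Definition ghw :=
  bieberbach /\
  exists f : holonomy -> 'rV['Z_2]_n.-1,
    bijective f /\ {morph f : x y / (x * y)%g >-> x + y}.

(* The translation subgroup, identified with a subgroup of R^n. *)
Definition lattice : set 'cV[R]_n := [set v | translation v \in Gamma].

Definition zcomb (b : 'I_n -> 'cV[R]_n) (z : 'cV[int]_n) : 'cV[R]_n :=
  \sum_i b i *~ z i 0.

Definition lattice_basis (b : 'I_n -> 'cV[R]_n) :=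
  set_bij [set: 'cV[int]_n] lattice (zcomb b).

(* [rho] is the conjugation action of the holonomy group on the lattice,
   written in the coordinates given by [b]. *)
Definition integral_holonomy_rep
    (b : 'I_n -> 'cV[R]_n) (rho : holonomy -> 'M[int]_n) :=
  forall (g : subgroup Gamma) (z : 'cV[int]_n),
    (val g * translation (zcomb b z) * (val g)^-1)%g =
    translation (zcomb b (rho (\pi_(quotient_group translations)%qT g) *m z)).

End Bieberbach.

Definition ghw_holonomy_image (R : realType) (n : nat) : set (set 'M[int]_n) :=
  [set H | exists Gamma : groupClosed (euclid R n), ghw Gamma /\
     exists (b : 'I_n -> 'cV[R]_n) (rho : holonomy Gamma -> 'M[int]_n),
       [/\ lattice_basis Gamma b, integral_holonomy_rep b rho & H = range rho]].

Arguments ghw_holonomy_image : clear implicits.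

Definition GLZ_conj (n : nat) (H K : set 'M[int]_n) :=
  exists2 P : 'M[int]_n, P \in unitmx & K = [set P *m A *m invmx P | A in H].

Definition ghw_holonomy_classes (R : realType) (n : nat) :
    set (set (set 'M[int]_n)) :=
  [set [set K | GLZ_conj H K] | H in ghw_holonomy_image R n].

Arguments ghw_holonomy_classes : clear implicits.

(* Main.v *)
Require Import Defs.
From HB Require Import structures.
From mathcomp Require Import all_boot all_order all_algebra.
From mathcomp Require Import perm.
From mathcomp Require Import all_classical all_reals all_analysis.
From mathcomp Require Import ring lra zify.

(** Let Gamma be a generalized Hantzsche-Wendt group of dimension n. Its linear
    parts are commuting involutions, so in a suitable real basis they are
    diagonal matrices of signs, and Gamma acts by isometries on each of the n
    coordinate lines. The matrix -1 is not a linear part, since motions with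
    that linear part have order 2 and Gamma is torsion-free. As the holonomy has
    order 2^(n-1), exactly one of e and -e is a linear part, for every sign
    vector e.

    The main point is that the lattice of translations splits as the sum of its
    intersections with the coordinate lines ([translation_components]). The flip
    of some line k is not a linear part, so its opposite, which reverses every
    line but k, is the linear part of some motion c of Gamma. The square of c is
    a translation along the line k, and so is the square of every translate of
    c. Freeness of the action says that c, composed with any translation of
    Gamma, displaces the line k. Since the translations along the line k form a
    cyclic group, there is room for one nontrivial class of half translations
    only; it is taken by c, so the k-th component of every translation of Gamma
    is itself a translation of Gamma. The stabilizer of a suitable point of the
    line k then acts on the other lines under the same hypotheses, and induction
    on the number of lines splits the lattice.

    Generators of the n intersections thus form a basis of the lattice in which
    the holonomy consists of diagonal sign matrices. It has index 2 among all of
    them and misses -1, so it is the group of the sign vectors whose product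
    over a set S is 1, for some S of odd size ([ghw_holonomy_diagonal]). Permuting
    the basis shows that only the size of S matters, and this size is an
    invariant: n - #|S| is the number of elements of trace n - 2, that is, of
    reflections in the group ([diagonal_group_card]).

    Conversely every odd size occurs ([diagonal_group_realized]). Write a sign
    vector as a 0-1 vector h, with 1 for the sign -1; the motions with linear
    part h and translation part in h'/2 + Z^n, where h' is the cyclic shift of
    h, form a group. It is torsion-free because a vector h which is not constant
    has a 0 followed by a 1 somewhere on the cycle, and there the motion
    translates by half an odd integer; the constant vector 1 is excluded as S is odd.

    The classes are therefore counted by the odd integers between 1 and n. *)

Set Implicit Arguments.
Unset Strict Implicit.
Unset Printing Implicit Defensive.
Import Order.TTheory GRing.Theory Num.Theory numFieldNormedType.Exports.
Local Open Scope ring_scope.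

(** * Groups acting on a family of lines by isometries *)

Section LineActions.
Variables (I : finType) (R : realFieldType) (G : groupType).
Variables (sg : G -> I -> bool) (tr : G -> I -> R).

(** The sign [sg g i] tells whether [g] reverses the line [i], and [tr g i] is
    the image of the origin of that line. *)
Definition line_act g i x := (-1) ^+ sg g i * x + tr g i.

Definition is_translation g := forall i, sg g i = false.

Definition axis_translation k x :=
  exists g, [/\ is_translation g, tr g k = x & forall j, j != k -> tr g j = 0].

(** The induction on the number of lines replaces the group by the stabilizer
    of one point on each line outside [J], and this stabilizer is seen through
    its action on the lines of [J]. *)
Definition fixes_off (J : {set I}) (p : I -> R) g :=
  forall i, i \notin J -> line_act g i (p i) = p i.

Implicit Types (J : {set I}) (p : I -> R) (g h : G) (i j k : I).

Hypothesis sgM : forall g h i, sg (g * h)%g i = sg g i (+) sg h i.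
Hypothesis trM : forall g h i,
  tr (g * h)%g i = (-1) ^+ sg g i * tr h i + tr g i.
Hypothesis free : forall g,
  (forall i, sg g i = false -> tr g i = 0) -> is_translation g.
Hypothesis cyclic_axes : forall k, exists l, forall x,
  axis_translation k x <-> exists z : int, x = l *~ z.

Lemma sg1 i : sg 1%g i = false.
Proof. by have := sgM 1%g 1%g i; rewrite mulg1; case: (sg _ _). Qed.

Lemma tr1 i : tr 1%g i = 0.
Proof. by have := trM 1%g 1%g i; rewrite mulg1 sg1 expr0; lra. Qed.

Lemma sgV g i : sg g^-1%g i = sg g i.
Proof.
by have := sgM g g^-1%g i; rewrite mulgV sg1; do 2!case: (sg _ _).
Qed.

Lemma trV g i : tr g^-1%g i = - ((-1) ^+ sg g i * tr g i).
Proof.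
have := trM g^-1%g g i; rewrite mulVg tr1 sgV => /esym/eqP.
by rewrite addrC addr_eq0 => /eqP.
Qed.

Lemma line_actM g h i x :
  line_act (g * h)%g i x = line_act g i (line_act h i x).
Proof. by rewrite /line_act trM sgM signr_addb; ring. Qed.

Lemma line_act_translation g i x :
  is_translation g -> line_act g i x = x + tr g i.
Proof. by rewrite /line_act => ->; rewrite expr0 mul1r. Qed.

Lemma is_translationM g h :
  is_translation g -> is_translation h -> is_translation (g * h)%g.
Proof. by move=> gT hT i; rewrite sgM gT hT. Qed.

Lemma is_translationV g : is_translation g -> is_translation g^-1%g.
Proof. by move=> gT i; rewrite sgV. Qed.

Lemma is_translation_sqr g : is_translation (g * g)%g.
Proof. by move=> i; rewrite sgM addbb. Qed.

Lemma axis_translationD k x y :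
  axis_translation k x -> axis_translation k y -> axis_translation k (x + y).
Proof.
move=> [g [gT gk g0]] [h [hT hk h0]]; exists (g * h)%g; split.
- exact: is_translationM.
- by rewrite trM gT gk hk expr0; ring.
- by move=> j jk; rewrite trM gT g0 // h0 // expr0; ring.
Qed.

Lemma axis_translationN k x : axis_translation k x -> axis_translation k (- x).
Proof.
move=> [g [gT gk g0]]; exists g^-1%g; split.
- exact: is_translationV.
- by rewrite trV gT gk expr0; ring.
- by move=> j jk; rewrite trV gT g0 // expr0; ring.
Qed.

(** The halves of the elements of a cyclic group make up at most two cosets of
    it, so two halves outside the group differ by an element of it. *)
Lemma axis_translation_halves k x y :
  axis_translation k (x + x) -> axis_translation k (y + y) ->
  [\/ axis_translation k x, axis_translation k y | axis_translation k (x - y)].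
Proof.
have [l lP] := cyclic_axes k => /lP[a xa] /lP[b yb].
have half u c : u + u = l *~ (c + c) -> u = l *~ c by rewrite mulrzDr; lra.
have even_odd (c : int) : (exists d, c = d + d) \/ exists d, c = d + d + 1.
  by have := divz_eq c 2; have := modz_ge0 c (isT : 2 != 0 :> int);
    have := ltz_pmod c (isT : 0 < 2 :> int);
    case: (c %% 2)%Z => // -[|[|m]] //= _ _ E; [left|right];
    exists (c %/ 2)%Z; rewrite {1}E; ring.
have [[a' Ea]|[a' Ea]] := even_odd a.
  by constructor 1; apply/lP; exists a'; apply: half; rewrite xa Ea.
have [[b' Eb]|[b' Eb]] := even_odd b.
  by constructor 2; apply/lP; exists b'; apply: half; rewrite yb Eb.
constructor 3; apply/lP; exists (a' - b'); apply: half.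
have -> : x - y + (x - y) = (x + x) - (y + y) by ring.
by rewrite xa yb -mulrzBr Ea Eb; congr (_ *~ _); ring.
Qed.

Lemma fixes_offM J p g h :
  fixes_off J p g -> fixes_off J p h -> fixes_off J p (g * h)%g.
Proof. by move=> gP hP i iJ; rewrite line_actM hP // gP. Qed.

Lemma fixes_off_translation J p g :
  is_translation g -> fixes_off J p g <-> forall i, i \notin J -> tr g i = 0.
Proof.
move=> gT; split=> gJ i /gJ; rewrite ?line_act_translation // => E.
  by apply: (addrI (p i)); rewrite E addr0.
by rewrite E addr0.
Qed.

Lemma axis_fixes_off J p k x : k \in J -> axis_translation k x ->
  exists g, [/\ is_translation g, fixes_off J p g & tr g k = x].
Proof.
move=> kJ [g [gT gx g0]]; exists g; split=> //.
apply/fixes_off_translation => //.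
by move=> i iJ; apply: g0; apply: contraNneq iJ => ->.
Qed.

Lemma fixes_off_eq0 J p g i :
  fixes_off J p g -> i \notin J -> sg g i = false -> tr g i = 0.
Proof.
move=> gJ iJ gi; have := gJ i iJ; rewrite /line_act gi expr0 mul1r => E.
by apply: (addrI (p i)); rewrite E addr0.
Qed.

(** This stands for the count of sign vectors, half of them being realized: it
    passes to stabilizers of points without any counting. *)
Definition sign_complete J p := forall e : I -> bool, exists g,
  fixes_off J p g /\ ((forall i, i \in J -> sg g i = e i) \/
                      (forall i, i \in J -> sg g i = ~~ e i)).

Definition sign_faithful J p := forall g,
  fixes_off J p g -> (forall i, i \in J -> sg g i = false) -> is_translation g.

(** If all the flips of lines of [J] were realized, so would be their product,
    by a motion reversing all the lines of [J] and fixing a point on each of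
    the other lines; freeness excludes it. *)
Lemma exists_excluded_flip J p : J != finset.set0 -> exists2 k, k \in J &
  forall g, fixes_off J p g -> ~ (forall i, i \in J -> sg g i = (i == k)).
Proof.
move=> /set0Pn[k0 k0J].
have [[k kJ kP]|nk] : (exists2 k, k \in J &
    forall g, fixes_off J p g -> ~ (forall i, i \in J -> sg g i = (i == k)))
    \/ ~ (exists2 k, k \in J &
    forall g, fixes_off J p g -> ~ (forall i, i \in J -> sg g i = (i == k))).
    exact: EM.
  by exists k.
have all_flips k : k \in J ->
    exists2 g, fixes_off J p g & forall i, i \in J -> sg g i = (i == k).
  move=> kJ; apply: contrapT => nok; apply: nk; exists k => // g gJ gk.
  by apply: nok; exists g.
have [g gJ gi] : exists2 g, fixes_off J p g &
    forall i, i \in J -> sg g i = (i \in enum J).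
  have : {subset enum J <= J} by move=> i; rewrite mem_enum.
  elim: (enum J) (enum_uniq J) => [_ _|k s IH /= /andP[ks us] sJ].
    exists 1%g => [|i _]; last by rewrite sg1.
    by apply/fixes_off_translation => i; rewrite ?sg1 ?tr1.
  have [g gJ gs] := IH us (fun i si => sJ i (mem_behead (s := k :: s) si)).
  have [h hJ hk] := all_flips k (sJ k (mem_head _ _)).
  exists (h * g)%g => [|i iJ]; first exact: fixes_offM.
  rewrite sgM hk // gs // inE; case: eqP => [->|//].
  by rewrite (negbTE ks).
have /(_ k0) : is_translation g.
  apply: free => i gF; apply: (fixes_off_eq0 gJ) => //.
  by apply: contraFN gF => iJ; rewrite gi // mem_enum.
by rewrite gi // mem_enum k0J.
Qed.

Section Step.
Variables (J : {set I}) (p : I -> R) (k : I) (c : G).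
Hypotheses (kJ : k \in J) (cJ : fixes_off J p c).
Hypothesis csg : forall i, i \in J -> sg c i = (i != k).
Hypothesis c_flips : ~ is_translation c.

(** The motion [t * c] has the signs of [c], so it is not a translation. It
    has a fixed point on every line but [k], so by freeness it has none on
    [k]. *)
Lemma glide_neq0 t :
  is_translation t -> fixes_off J p t -> tr t k + tr c k != 0.
Proof.
move=> tT tJ; apply/eqP => tc0; apply: c_flips => i.
have <- : sg (t * c)%g i = sg c i by rewrite sgM tT.
apply: free i => i ci; have [iJ|iJ] := boolP (i \in J); last first.
  by apply: (fixes_off_eq0 (fixes_offM tJ cJ)).
move: ci; rewrite sgM tT csg // => /negbFE/eqP->.
by rewrite trM tT expr0 mul1r addrC.
Qed.

Lemma glide_sqr t : is_translation t -> fixes_off J p t ->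
  axis_translation k ((tr t k + tr c k) + (tr t k + tr c k)).
Proof.
move=> tT tJ; exists ((t * c) * (t * c))%g.
split=> [||j jk]; first exact: is_translation_sqr.
  by rewrite trM sgM tT csg // eqxx trM tT expr0; ring.
have [jJ|jJ] := boolP (j \in J).
  by rewrite trM sgM tT csg // jk /= expr1; ring.
have tcJ := fixes_offM tJ cJ.
exact: fixes_off_eq0 (fixes_offM tcJ tcJ) jJ (is_translation_sqr _ _).
Qed.

Lemma id_fixes_off : fixes_off J p 1%g.
Proof. by apply/fixes_off_translation => i; rewrite ?sg1 ?tr1. Qed.

Lemma glide_half : axis_translation k (tr c k + tr c k).
Proof.
by have := glide_sqr sg1 id_fixes_off; rewrite tr1 add0r.
Qed.

Lemma glide_not_axis : ~ axis_translation k (tr c k).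
Proof.
move=> /axis_translationN /(axis_fixes_off p kJ)[t [tT tJ tk]].
by have := glide_neq0 tT tJ; rewrite tk addNr eqxx.
Qed.

(** Both [tr c k] and its sum with [tr t k] are halves of axis translations,
    hence so is [tr t k]. Were the latter not an axis translation, it would be
    one modulo [tr c k], and some translate of [c] would fix the line [k]
    pointwise. *)
Lemma axis_component t :
  is_translation t -> fixes_off J p t -> axis_translation k (tr t k).
Proof.
move=> tT tJ; have tc2 := glide_sqr tT tJ.
have t2 : axis_translation k (tr t k + tr t k).
  have := axis_translationD tc2 (axis_translationN glide_half).
  by congr (axis_translation _ _); ring.
have [//|/glide_not_axis//|] := axis_translation_halves t2 glide_half.
move=> /(axis_fixes_off p kJ)[u [uT uJ uk]].
(* The translation [u * t^-1] would cancel the displacement of [c]. *)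
have : tr (u * t^-1)%g k + tr c k != 0.
  apply: glide_neq0; first exact: is_translationM uT (is_translationV tT).
  apply: fixes_offM uJ _; apply/fixes_off_translation => [|i iJ].
    exact: is_translationV.
  by rewrite trV (fixes_off_eq0 tJ iJ (tT i)) mulr0 oppr0.
by rewrite trM trV uT tT uk expr0; move/eqP; case; ring.
Qed.

(** The point is the fixed point on the line [k] of a motion [d] reversing
    this line, if there is one. A motion preserving the orientation of the
    line has a translation as its square, and any other motion is brought to
    this case by composing it with [d]. *)
Lemma exists_half_orbit : exists q, forall g, fixes_off J p g ->
  axis_translation k ((line_act g k q - q) + (line_act g k q - q)).
Proof.
have pos g q : fixes_off J p g -> sg g k = false ->
    axis_translation k ((line_act g k q - q) + (line_act g k q - q)).
  move=> gJ gk; have := axis_component (@is_translation_sqr g) (fixes_offM gJ gJ).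
  by rewrite /line_act trM gk expr0; congr (axis_translation _ _); ring.
have [[d dJ dk]|nod] : (exists2 d, fixes_off J p d & sg d k)
    \/ ~ (exists2 d, fixes_off J p d & sg d k).
  exact: EM.
- exists (tr d k / 2) => g gJ; case gk: (sg g k); last exact: pos.
  have := pos (d * g)%g (tr d k / 2) (fixes_offM dJ gJ).
  rewrite sgM gk dk => /(_ erefl)/axis_translationN.
  rewrite line_actM /line_act gk dk !expr1.
  by congr (axis_translation _ _); field.
- exists 0 => g gJ; apply: pos => //.
  by apply/negP => gk; apply: nod; exists g.
Qed.

Hypothesis complete : sign_complete J p.
Hypothesis faithful : sign_faithful J p.
Hypothesis no_flip : forall g,
  fixes_off J p g -> ~ (forall i, i \in J -> sg g i = (i == k)).

(** Displacements of the half-orbit point on the line [k] are axis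
    translations either directly or after adding [tr c k]. So one of [g] and
    [g * c] can be corrected by a translation into a motion fixing that point.
    Since [c] reverses every line of [J] but [k], this choice costs a global
    sign on the remaining lines, which is what [sign_complete] leaves
    undetermined. *)
Lemma point_stabilizer : exists q : I -> R,
  sign_complete (J :\ k) q /\ sign_faithful (J :\ k) q.
Proof.
have [x xP] := exists_half_orbit.
pose q i := if i == k then x else p i.
have qk g : fixes_off (J :\ k) q g <->
    fixes_off J p g /\ line_act g k x = x.
  split=> [gq|[gJ gx] i].
    split=> [i iJ|]; last by have := gq k; rewrite /q !inE eqxx => ->.
    have := gq i; rewrite !inE (negbTE iJ) andbF /q.
    by case: eqP iJ => [->|_ _ ->//]; rewrite kJ.
  by rewrite !inE negb_and negbK /q; case: eqP => [->|_ /gJ].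
have adjust g : fixes_off J p g -> axis_translation k (line_act g k x - x) ->
    exists2 h, fixes_off (J :\ k) q h & forall i, sg h i = sg g i.
  move=> gJ /axis_translationN /(axis_fixes_off p kJ)[t [tT tJ tk]].
  exists (t * g)%g => [|i]; last by rewrite sgM tT.
  apply/qk; split; first exact: fixes_offM.
  by rewrite line_actM line_act_translation // tk; ring.
exists q; split=> [e|g /qk[gJ gx] gF].
- have [g [gJ ge]] := complete e.
  have [a|/glide_not_axis//|a] := axis_translation_halves (xP g gJ) glide_half.
    have [h hq hg] := adjust g gJ a; exists h; split=> //.
    by case: ge => ge; [left|right] => i /setD1P[_ iJ]; rewrite hg ge.
  have a' : axis_translation k (line_act (g * c)%g k x - x).
    rewrite line_actM {2}/line_act csg // eqxx expr0.
    case gk: (sg g k).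
      by move: a; rewrite /line_act gk expr1; congr (axis_translation _ _); ring.
    have := axis_translationD a glide_half.
    by rewrite /line_act gk expr0; congr (axis_translation _ _); ring.
  have [h hq hg] := adjust _ (fixes_offM gJ cJ) a'; exists h; split=> //.
  by case: ge => ge; [right|left] => i /setD1P[ik iJ];
    rewrite hg sgM csg // ik ge // addbT ?negbK.
- case gk: (sg g k).
    case: (no_flip gJ) => i iJ; have [->//|ik] := eqVneq i k.
    by apply: gF; rewrite !inE ik.
  apply: faithful => // i iJ; have [->//|ik] := eqVneq i k.
  by apply: gF; rewrite !inE ik.
Qed.

End Step.

Lemma translation_components_rec m J p :
  (#|J| <= m)%N -> sign_complete J p -> sign_faithful J p ->
  forall t, is_translation t -> (forall i, i \notin J -> tr t i = 0) ->
  forall j, axis_translation j (tr t j).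
Proof.
have axis0 k : axis_translation k 0.
  by exists 1%g; split=> *; rewrite ?tr1 // => i; rewrite sg1.
elim: m J p => [|m IH] J p Jm complete faithful t tT tJ j.
  rewrite tJ //; apply/negP => jJ.
  by move: Jm; rewrite leqn0 cards_eq0 => /eqP J0; rewrite J0 inE in jJ.
have [jJ|/tJ->//] := boolP (j \in J).
have /(exists_excluded_flip p)[k kJ no_flip] : J != finset.set0.
  by apply/set0Pn; exists j.
have tfix : fixes_off J p t by apply/fixes_off_translation.
(* If [k] is the only line of [J], then [t] itself is a translation along it. *)
have [J1|/subsetPn[j' j'J]] := boolP (J \subset [set k]).
  have jk i : i != j -> i \notin J.
    move=> ij; apply: contra ij => /(fintype.subsetP J1)/set1P->.
    by have /(fintype.subsetP J1)/set1P-> := jJ.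
  by exists t; split=> // i /jk/tJ.
rewrite inE => j'k; have [c [cJ [/no_flip//|csg]]] := complete (pred1 k).
have nc : ~ is_translation c by move/(_ j'); rewrite csg //= j'k.
have [q [qc qf]] := point_stabilizer kJ cJ csg nc complete faithful no_flip.
have tk := axis_component kJ cJ csg nc tT tfix.
have [->//|jk] := eqVneq j k.
have [u [uT uk u0]] := tk.
(* Without its component along [k], [t] only moves the lines of [J :\ k]. *)
have -> : tr t j = tr (t * u^-1)%g j.
  by rewrite trM trV tT uT u0 //; ring.
have Jk : (#|J :\ k| <= m)%N by rewrite (cardsD1 k) kJ in Jm.
apply: (IH _ q Jk qc qf); first exact: is_translationM tT (is_translationV uT).
move=> i; rewrite !inE negb_and negbK trM trV tT uT expr0 => /orP[/eqP->|iJ].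
  by rewrite uk; ring.
by rewrite tJ // u0; [ring | apply: contraNneq iJ => ->].
Qed.

(** Only the isometries of the single lines enter, and no metric on their
    product; this allows the linear parts of a Euclidean group to be
    diagonalized in a basis which need not be orthonormal. *)
Theorem translation_components :
  (forall e : I -> bool, exists g,
     (forall i, sg g i = e i) \/ (forall i, sg g i = ~~ e i)) ->
  forall t, is_translation t -> forall j, axis_translation j (tr t j).
Proof.
move=> complete t tT;
apply: (@translation_components_rec _ finset.setT (fun=> 0)) => //.
- move=> e; have [g ge] := complete e; exists g; split=> [i|]; first by rewrite inE.
  by case: ge => ge; [left|right].
- by move=> g _ gF i; apply: gF.
- by move=> i; rewrite inE.
Qed.

End LineActions.

Local Open Scope classical_set_scope.

(** * Groups of sign vectors *)

Section SignVectors.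
Variable I : finType.
Implicit Types (S T : {set I}) (h e : I -> bool).

Definition sign_parity S h := \big[addb/false]_(i in S) h i.

Lemma sign_parityD S h e :
  sign_parity S (fun i => h i (+) e i) = sign_parity S h (+) sign_parity S e.
Proof. exact: big_split. Qed.

Lemma sign_parity_true S : sign_parity S (fun=> true) = odd #|S|.
Proof.
rewrite /sign_parity big_const; elim: #|_| => //= m ->; by case: (odd m).
Qed.

Lemma sign_parity_flip S k : sign_parity S (pred1 k) = (k \in S).
Proof.
rewrite /sign_parity; have [kS|kS] := boolP (k \in S).
  rewrite (bigD1 k) //= eqxx big1 // => i /andP[_ /negbTE] //.
by rewrite big1 // => i iS; apply: contraNF kS => /eqP <-.
Qed.

Lemma eq_sign_parity S h e : h =1 e -> sign_parity S h = sign_parity S e.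
Proof. by move=> he; apply: eq_bigr. Qed.

(** A sum of two vectors outside [H] is the sum of their opposites, which lie
    in [H]. So being outside [H] is a homomorphism to Z/2, which is determined
    by the set [S] of the flips outside [H]; its value on the constant vector
    is the parity of [S]. *)
Lemma index2_sign_group (H : (I -> bool) -> Prop) :
  (forall h e, H h -> H e -> H (fun i => h i (+) e i)) ->
  (forall h, H h \/ H (fun i => ~~ h i)) ->
  ~ H (fun=> true) ->
  exists2 S : {set I}, odd #|S| & forall h, H h <-> sign_parity S h = false.
Proof.
move=> HD HC nH1; pose chi h := ~~ `[< H h >].
have chiD h e : chi (fun i => h i (+) e i) = chi h (+) chi e.
  rewrite /chi; have [Hh|nh] := asboolP (H h);
    have [He|ne] := asboolP (H e) => /=.
  - by rewrite asboolT //; exact: HD.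
  - rewrite asboolF // => Hhe; apply: ne; have := HD _ _ Hh Hhe.
    by congr H; apply/funext => i; rewrite addbA addbb.
  - rewrite asboolF // => Hhe; apply: nh; have := HD _ _ Hhe He.
    by congr H; apply/funext => i; rewrite -addbA addbb addbF.
  - rewrite asboolT //.
    case: (HC h) => // Hh; case: (HC e) => // He; have := HD _ _ Hh He.
    by congr H; apply/funext => i; rewrite addNb addbN negbK.
pose S := [set k | chi (pred1 k)]%SET.
have chi0 : chi (fun=> false) = false.
  by have := chiD (fun=> false) (fun=> false); case: (chi _).
have chiE h : chi h = sign_parity S h.
  have -> : sign_parity S h = \big[addb/false]_(i <- enum I) (h i && chi (pred1 i)).
    rewrite big_enum /= /sign_parity big_mkcond /=; apply: eq_bigr => i _.
    by rewrite inE; case: (chi _); rewrite ?andbT ?andbF.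
  have -> : chi h = chi (fun i => (i \in enum I) && h i).
    by congr chi; apply/funext => i; rewrite mem_enum.
  elim: (enum I) (enum_uniq I) => [_|k s IH /= /andP[ks us]].
    by rewrite big_nil -chi0; congr chi; apply/funext => i; rewrite in_nil.
  rewrite big_cons -IH //.
  have -> : h k && chi (pred1 k) = chi (fun i => h k && (i == k)).
    by case: (h k) => //=; rewrite chi0.
  rewrite -chiD; congr chi; apply/funext => i; rewrite inE.
  by have [->|_] := eqVneq i k; rewrite ?(negbTE ks) ?andbT ?addbF ?andbF.
exists S => [|h].
  by rewrite -sign_parity_true -chiE /chi asboolF.
rewrite -chiE /chi; split=> [Hh|/negbFE/asboolP//]; by rewrite asboolT.
Qed.

(** The permutation matches the enumeration of [S] followed by that of its
    complement with the corresponding enumeration for [T]. *)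
Lemma perm_of_card S T : #|S| = #|T| ->
  exists s : {perm I}, forall i, (s i \in T) = (i \in S).
Proof.
move=> ST; have [i0 _|I0] := pickP (@predT I); last first.
  by exists (1%g : {perm I}) => i; have := I0 i.
pose en (A : {set I}) := enum A ++ enum (~: A).
have en_uniq A : uniq (en A).
  rewrite cat_uniq !enum_uniq andbT /=; apply/hasPn => i.
  by rewrite !mem_enum inE.
have en_mem A i : i \in en A by rewrite mem_cat !mem_enum inE orbN.
have en_size A : size (en A) = #|I| by rewrite size_cat -!cardE cardsC.
have idx A i : (index i (en A) < #|I|)%N by rewrite -(en_size A) index_mem.
pose f i := nth i0 (en T) (index i (en S)).
have f_inj : injective f.
  move=> i j /eqP; rewrite nth_uniq ?en_size ?idx // => /eqP ij.
  by rewrite -(nth_index i0 (en_mem S i)) ij nth_index.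
exists (perm f_inj) => i; rewrite permE /f nth_cat index_cat mem_enum -!cardE.
have [iS|iS] := boolP (i \in S).
  have iST : (index i (enum S) < #|T|)%N by rewrite -ST cardE index_mem mem_enum iS.
  by rewrite iST -mem_enum mem_nth // -cardE.
rewrite ST ltnNge leq_addr /= addKn.
have : nth i0 (enum (~: T)) (index i (enum (~: S))) \in enum (~: T).
  apply: mem_nth; rewrite -cardE; have /eqP := cardsC S.
  rewrite -(cardsC T) ST eqn_add2l => /eqP <-.
  by rewrite cardE index_mem mem_enum inE iS.
by rewrite mem_enum inE => /negbTE.
Qed.

End SignVectors.

(** * Diagonal sign matrices up to integral conjugacy *)

Lemma mulmx1_invmx (A : comUnitRingType) m (P Q : 'M[A]_m) :
  P *m Q = 1%:M -> invmx P = Q.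
Proof.
by move=> PQ; have [Pu _] := mulmx1_unit PQ; rewrite -[LHS]mulmx1 -PQ mulKmx.
Qed.

Local Open Scope card_scope.

Lemma card_eq_finset (T : finType) (A : {set T}) : [set` A] #= `I_#|A|.
Proof.
have -> : [set` A] = (@enum_val T (mem A)) @` [set: 'I_#|A|].
  apply/seteqP; split=> [x /= xA|_ [i _ <-]]; last exact: enum_valP.
  by exists (enum_rank_in xA x) => //; rewrite enum_rankK_in.
apply: card_eq_trans (inj_card_eq (in2W enum_val_inj)) _.
by rewrite card_eq_sym card_II.
Qed.

Definition sign_mx (A : pzRingType) n (h : 'I_n -> bool) : 'M[A]_n :=
  diag_mx (\row_i (-1) ^+ h i).

Lemma sign_mxM (A : pzRingType) n (h e : 'I_n -> bool) :
  sign_mx A h *m sign_mx A e = sign_mx A (fun i => h i (+) e i).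
Proof.
rewrite /sign_mx mulmx_diag; congr diag_mx; apply/rowP => i.
by rewrite !mxE signr_addb.
Qed.

Lemma sign_mx_false (A : pzRingType) n : sign_mx A (fun=> false) = 1%:M :> 'M[A]_n.
Proof. by apply/matrixP => i j; rewrite !mxE. Qed.

Lemma sign_mx_inj (A : numDomainType) n : injective (@sign_mx A n).
Proof.
move=> h e /matrixP he; apply/funext => i; have := he i i; rewrite !mxE eqxx.
by move/eqP; rewrite !mulr1n (inj_eq (@signr_inj _)) => /eqP.
Qed.

Lemma sign_mx_mul_col (A : pzRingType) n (h : 'I_n -> bool) (v : 'cV[A]_n) i j :
  (sign_mx A h *m v) i j = (-1) ^+ h i * v i j.
Proof. by rewrite mul_diag_mx !mxE. Qed.

Section Conjugacy.
Variable n : nat.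
Implicit Types (S T : {set 'I_n}) (h : 'I_n -> bool) (H K L : set 'M[int]_n).

Lemma GLZ_conj_refl H : GLZ_conj H H.
Proof.
exists 1%:M; first exact: unitmx1.
apply/seteqP; split=> [A HA|_ [A HA <-]]; last by rewrite invmx1 mul1mx mulmx1.
by exists A => //; rewrite invmx1 mul1mx mulmx1.
Qed.

Lemma GLZ_conj_sym H K : GLZ_conj H K -> GLZ_conj K H.
Proof.
move=> [P Pu ->]; exists (invmx P); first by rewrite unitmx_inv.
rewrite invmxK; apply/seteqP; split=> [A HA|_ [_ [A HA <-] <-]].
  exists (P *m A *m invmx P); first by exists A.
  by rewrite !mulmxA mulVmx // mul1mx mulmxKV.
by rewrite !mulmxA mulVmx // mul1mx mulmxKV.
Qed.

Lemma GLZ_conj_trans H K L : GLZ_conj H K -> GLZ_conj K L -> GLZ_conj H L.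
Proof.
move=> [P Pu ->] [Q Qu ->]; exists (Q *m P); first by rewrite unitmx_mul Qu.
have E A : Q *m (P *m A *m invmx P) *m invmx Q = Q *m P *m A *m invmx (Q *m P).
  rewrite (@mulmx1_invmx _ _ (Q *m P) (invmx P *m invmx Q)) !mulmxA //.
  by rewrite mulmxK // mulmxV.
apply/seteqP; split=> [_ [_ [A HA <-] <-]|_ [A HA <-]].
  by exists A; rewrite ?E.
by exists (P *m A *m invmx P); [exists A | rewrite E].
Qed.

Lemma GLZ_class_eq H K : GLZ_conj H K ->
  [set L | GLZ_conj H L] = [set L | GLZ_conj K L].
Proof.
move=> HK; apply/seteqP; split=> L /=.
  exact: GLZ_conj_trans (GLZ_conj_sym HK).
exact: GLZ_conj_trans.
Qed.

Definition diagonal_group S : set 'M[int]_n :=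
  [set sign_mx int h | h in [set h | sign_parity S h = false]].

Lemma diagonal_group_perm S T :
  #|S| = #|T| -> GLZ_conj (diagonal_group S) (diagonal_group T).
Proof.
move=> /esym/perm_of_card[s sST]; exists (perm_mx s); first exact: unitmx_perm.
have conjE h : perm_mx s *m sign_mx int h *m invmx (perm_mx s) = sign_mx int (h \o s).
  have -> : invmx (perm_mx s) = perm_mx (s^-1)%g :> 'M[int]_n.
    by apply: mulmx1_invmx; rewrite -perm_mxM mulgV perm_mx1.
  rewrite -row_permE -col_permE; apply/matrixP => i j.
  by rewrite !mxE (inj_eq perm_inj).
have parE h : sign_parity T (h \o s) = sign_parity S h.
  rewrite /sign_parity [RHS](reindex_inj (@perm_inj _ s)) /=.
  by apply: eq_bigl => i; rewrite sST.
apply/seteqP; split=> [_ [h hT <-]|_ [_ [h hS <-] <-]].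
  have hE : h = (h \o (s^-1)%g) \o s by apply/funext => i /=; rewrite permK.
  exists (sign_mx int (h \o (s^-1)%g)); last by rewrite conjE -hE.
  by exists (h \o (s^-1)%g) => //=; rewrite -parE -hE.
by rewrite conjE; exists (h \o s) => //=; rewrite parE.
Qed.

Lemma tr_sign_mx h : \tr (sign_mx int h) = n%:Z - (2 * #|h|)%:Z.
Proof.
rewrite mxtrace_diag; under eq_bigr do rewrite mxE.
rewrite (eq_bigr (fun i => 1 - 2 * (h i : nat)%:Z)); last first.
  by move=> i _; case: (h i).
rewrite sumrB sumr_const card_ord -mulr_sumr PoszM; congr (_ - _ * _).
  by rewrite natz.
rewrite -sum1_card (big_morph Posz PoszD (erefl _)) [RHS]big_mkcond /=.
by apply: eq_bigr => i _; rewrite unfold_in; case: (h i).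
Qed.

(** The trace of a sign matrix determines the number of its entries -1, and
    the reflection in the coordinate [k] has even parity over [S] exactly when
    [k] is not in [S]. *)
Lemma card_reflections S :
  [set A | diagonal_group S A /\ \tr A = n%:Z - 2] #= `I_#|~: S|.
Proof.
have -> : [set A | diagonal_group S A /\ \tr A = n%:Z - 2] =
    (fun k => sign_mx int (pred1 k)) @` [set` ~: S].
  apply/seteqP; split=> [_ [[h hS <-]]|_ [k /= kS <-]].
    rewrite tr_sign_mx => /addrI/oppr_inj/(congr1 absz) E.
    have /eqP/cards1P[k /setP hk] : #|[set i in h]%SET| = 1%N
      by rewrite cardsE; apply/eqP; rewrite -(@eqn_pmul2l 2) //; apply/eqP.
    have {}hk : h =1 pred1 k by move=> i; have := hk i; rewrite !inE.
    exists k; last by congr (sign_mx int _); apply/funext => i; rewrite hk.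
    by rewrite /= inE -sign_parity_flip -(eq_sign_parity _ hk) hS.
  split.
    exists (pred1 k) => //=; rewrite sign_parity_flip.
    by move: kS; rewrite inE => /negbTE.
  by rewrite tr_sign_mx card1.
have reflection_inj : injective (fun k : 'I_n => sign_mx int (pred1 k)).
  move=> i j ij; have /(congr1 (@^~ i)) := sign_mx_inj ij.
  by rewrite /= eqxx => /esym/eqP.
apply: card_eq_trans (inj_card_eq (in2W reflection_inj)) _.
exact: card_eq_finset.
Qed.

Lemma diagonal_group_card S T :
  GLZ_conj (diagonal_group S) (diagonal_group T) -> #|S| = #|T|.
Proof.
move=> [P Pu DT].
suff /card_eq_II E : `I_#|~: S| #= `I_#|~: T|.
  by have := cardsC S; rewrite -(cardsC T) E => /addIn.
rewrite card_eq_sym.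
apply: card_eq_trans (card_reflections S); rewrite card_eq_sym.
have trJ A : \tr (P *m A *m invmx P) = \tr A.
  by rewrite mxtrace_mulC mulmxA mulVmx // mul1mx.
apply: card_eq_trans (card_reflections T); rewrite card_eq_sym.
have -> : [set A | diagonal_group T A /\ \tr A = n%:Z - 2] =
    (fun A => P *m A *m invmx P) @`
      [set A | diagonal_group S A /\ \tr A = n%:Z - 2].
  rewrite DT; apply/seteqP; split=> [_ [[A SA <-]]|_ [A [SA trA] <-]].
    by rewrite trJ => trA; exists A.
  by rewrite /= trJ; split=> //; exists A.
apply: inj_card_eq => A B _ _ /(congr1 (fun C => invmx P *m C *m P)).
by rewrite !mulmxA !mulVmx // !mul1mx !mulmxKV.
Qed.

End Conjugacy.

(** * Discreteness in the Euclidean group *)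

(** Elements at distance less than [e] coincide, so there is a smallest
    positive element, and division with remainder shows that it generates. *)
Lemma discrete_cyclic (R : realType) (A : R -> Prop) (e : R) :
  0 < e -> A 0 -> (forall x y, A x -> A y -> A (x - y)) ->
  (forall x, A x -> `|x| < e -> x = 0) ->
  exists l, forall x, A x <-> exists z : int, x = l *~ z.
Proof.
move=> e0 A0 AB Ae.
have AN x : A x -> A (- x) by rewrite -sub0r; exact: AB.
have AD x y : A x -> A y -> A (x + y).
  by move=> Ax Ay; rewrite -[y]opprK; exact: AB (AN _ Ay).
have AM x (z : int) : A x -> A (x *~ z).
  move=> Ax; case: z => k; last rewrite NegzE mulrNz; last apply: AN;
    rewrite -pmulrn; elim: k => [|k IH]; rewrite ?mulr0n // mulrS; exact: AD.
have [[a [Aa a0]]|noA] := pselect (exists a, A a /\ 0 < a); last first.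
  exists 0 => x; split=> [Ax|[z ->]]; last by rewrite mul0rz.
  exists 0; rewrite mulr0z; case: (ltgtP x 0) => // x0; case: noA.
    by exists (- x); split; [exact: AN | rewrite oppr_gt0].
  by exists x.
have exk : exists k : nat, `[< exists x, [/\ A x, 0 < x & x < e *+ k] >].
  exists (Num.bound (a / e)); apply/asboolP; exists a; split=> //.
  rewrite -mulr_natr mulrC -ltr_pdivrMr //.
  by apply: le_lt_trans (archi_boundP _); rewrite ?ler_norm // divr_ge0 ?ltW.
case: (ex_minnP exk) => k /asboolP[l [Al l0 lk]] kmin.
have lmin y : A y -> 0 < y -> l <= y.
  move=> Ay y0; rewrite leNgt; apply/negP => yl.
  suff : l - y = 0 by lra.
  apply: Ae; first exact: AB.
  rewrite gtr0_norm; last lra.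
  rewrite ltNge; apply/negP => ely.
  case: k lk kmin => [|k] lk kmin; first by move: lk; rewrite mulr0n; lra.
  suff /kmin : `[< exists x, [/\ A x, 0 < x & x < e *+ k] >] by rewrite ltnn.
  by apply/asboolP; exists y; split=> //; move: lk; rewrite mulrS; lra.
exists l => x; split=> [Ax|[z ->]]; last exact: AM.
exists (Num.floor (x / l)).
have xl : 0 <= x - l *~ Num.floor (x / l).
  by rewrite subr_ge0 -mulrzr mulrC -ler_pdivlMr // floor_le.
have xl' : x - l *~ Num.floor (x / l) < l.
  have -> : l *~ Num.floor (x / l) = l * (Num.floor (x / l) + 1)%:~R - l.
    by rewrite intrD mulrDr mulr1 addrK mulrzr.
  by rewrite opprB addrCA gtrDl subr_lt0 mulrC -ltr_pdivrMr // floorD1_gt.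
have Axl := AB _ _ Ax (AM _ (Num.floor (x / l)) Al).
apply/eqP; rewrite -subr_eq0; apply/negPn/negP => xl0.
by have := lmin _ Axl; rewrite lt_def xl0 xl => /(_ isT); lra.
Qed.

Lemma cvg_mx (R : topologicalType) m n T (F : set_system T) (f : T -> 'M[R]_(m, n))
    (M : 'M[R]_(m, n)) : Filter F ->
  (forall i j, (fun x => f x i j) @ F --> M i j) -> f @ F --> M.
Proof.
move=> FF fM A [P MP PA].
have : \forall x \near F, forall i, forall j, P i j (f x i j).
  by apply: filter_forall => i; apply: filter_forall => j; exact: fM.
by apply: filterS => x Px; apply: PA.
Qed.

Section Euclid.
Variables (R : realType) (n : nat).

Lemma translation_inj : injective (@translation R n).
Proof. by move=> v w /(congr1 (@trans_part R n)). Qed.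

Lemma translationD (v w : 'cV[R]_n) :
  translation (v + w) = (translation v * translation w)%g.
Proof.
apply: euclid_eq; first by rewrite linear_partM mulmx1.
by rewrite trans_partM mul1mx addrC.
Qed.

Lemma translationN (v : 'cV[R]_n) : translation (- v) = (translation v)^-1%g.
Proof.
apply: euclid_eq; first by rewrite linear_partV trmx1.
by rewrite /trans_part /= trmx1 mul1mx.
Qed.

Lemma conj_translation (g : euclid R n) v :
  (g * translation v * g^-1)%g = translation (linear_part g *m v).
Proof.
apply: euclid_eq; first by rewrite !linear_partM mulmx1 linear_partP.
rewrite !trans_partM linear_partM mulmx1.
rewrite [trans_part g^-1%g]/trans_part /= mulmxN mulmxA linear_partP mul1mx.
by rewrite addrC addrK.
Qed.

Lemma cvg_euclid T (F : set_system T) (f : T -> euclid R n) (g : euclid R n) :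
  Filter F ->
  (forall i j, (fun x => linear_part (f x) i j) @ F --> linear_part g i j) ->
  (forall i j, (fun x => trans_part (f x) i j) @ F --> trans_part g i j) ->
  f @ F --> g.
Proof.
move=> FF /cvg_mx fL /cvg_mx ft A; rewrite nbhsE => -[B [[C oC <-] Cg] BA].
have [[U V] /= [gU gV] UV] : nbhs (euclid_val g) C by apply: open_nbhs_nbhs.
have FU : \forall x \near F, U (linear_part (f x)) := fL _ gU.
have FV : \forall x \near F, V (trans_part (f x)) := ft _ gV.
by apply: filterS2 FU FV => x Ux Vx; apply: BA; apply: UV.
Qed.

Lemma discrete_translations (Gamma : groupClosed (euclid R n)) (v : 'cV[R]_n) :
  discrete_subgroup Gamma -> v != 0 ->
  exists2 e : R, 0 < e &
    forall x, translation (x *: v) \in Gamma -> `|x| < e -> x = 0.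
Proof.
move=> /(_ 1%g gpred1) [_ [U U1 UG]] v0.
have tc : (fun x : R => translation (x *: v)) @ (0 : R) --> (1%g : euclid R n).
  apply: cvg_euclid => i j; first exact: cvg_cst.
  rewrite ord1 (_ : trans_part 1%g i 0 = 0 * v i 0); last by rewrite mul0r [LHS]mxE.
  rewrite [X in X @ _](_ : _ = *%R^~ (v i 0)); first exact: mulrr_continuous.
  by apply/funext => x; rewrite [LHS]mxE.
have /nbhs_ballP[e /= e0 eU] := tc _ U1.
exists e => // x xG xe.
have : (U `&` [set` Gamma]) (translation (x *: v)).
  by split=> //; apply: eU; rewrite /ball /= sub0r normrN.
rewrite UG => /= /(congr1 (@trans_part R n)) /eqP.
by rewrite scaler_eq0 (negbTE v0) orbF => /eqP.
Qed.

End Euclid.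

(** * The holonomy representation of a generalized Hantzsche-Wendt group *)

(** The minimal polynomial of an involution divides (X - 1)(X + 1), so each
    matrix is diagonalizable, and commutation makes a common basis possible. *)
Lemma involutions_codiagonalizable (F : numFieldType) m (As : seq 'M[F]_m.+1) :
  (forall A, A \in As -> A *m A = 1%:M) ->
  (forall A B, A \in As -> B \in As -> A *m B = B *m A) ->
  exists2 P, P \in unitmx & forall A, A \in As ->
    exists h : 'I_m.+1 -> bool, P *m A = sign_mx F h *m P.
Proof.
have n1 : (1 == -1 :> F) = false.
  by rewrite -subr_eq0 opprK -[1 + 1]/2%:R pnatr_eq0.
move=> A2 AC; have /codiagonalizableP[P Pu /allP PD] :
    {in As &, forall A B, comm_mx A B} /\ {in As, forall A, diagonalizable A}.
  split=> [A B AAs BAs|A AAs]; first exact: AC.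
  apply/diagonalizableP; exists [:: 1; -1].
    by rewrite /= inE andbT n1.
  rewrite big_cons big_seq1; apply: mxminpoly_min.
  rewrite rmorphM /= !rmorphB /= horner_mx_X !horner_mx_C.
  rewrite rmorphN -[X in X = 0]/(_ *m _) mulmxBl !mulmxBr A2 //.
  rewrite !mulmxN ?mul1mx ?mulmx1 !opprK.
  by apply/eqP; rewrite subr_eq0; apply/eqP; exact: addrC.
exists P => // A AAs; have /= /diagonalizable_forPex[d /(simmxP Pu) PA] := PD A AAs.
have D2 : diag_mx d *m diag_mx d = 1%:M.
  have E : diag_mx d = P *m A *m invmx P by rewrite PA mulmxK.
  by rewrite {1}E -mulmxA E !mulmxA mulmxKV // -(mulmxA P) A2 // mulmx1 mulmxV.
have d1 i : d 0 i = 1 \/ d 0 i = -1.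
  move/matrixP/(_ i i): D2; rewrite mulmx_diag !mxE eqxx /= => /eqP.
  by rewrite -expr2 sqrf_eq1 => /orP[]/eqP; [left|right].
exists (fun i => d 0 i != 1); rewrite PA /sign_mx; congr (diag_mx _ *m _).
apply/rowP => i; rewrite mxE; have [->|E] := d1 i; first by rewrite eqxx.
by rewrite E eq_sym n1.
Qed.

Section Holonomy.
Variables (R : realType) (m : nat) (Gamma : groupClosed (euclid R m.+1)).
Local Notation G := (subgroup Gamma).
Local Notation L g := (linear_part (val (g : G))).
Local Notation Q := (quotient_group (@translations R m.+1 Gamma)).

Lemma holonomy_eq (g h : G) : \pi_Q%qT g = \pi_Q%qT h <-> L g = L h.
Proof.
have E : (g^-1 * h)%g \in @translations R m.+1 Gamma <-> L g = L h.
  rewrite unfold_in /translations valM gmulfV linear_partM linear_partV.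
  split=> [/eqP gh|->]; last by rewrite linear_partVP.
  by rewrite -[RHS]mul1mx -(linear_partP (val g)) -mulmxA gh mulmx1.
by rewrite -E; split=> /quotient_groupP.
Qed.

Lemma linear_part_val1 : L 1%g = 1%:M.
Proof. by rewrite val1 linear_part1. Qed.

Lemma linear_part_valM (g h : G) : L (g * h)%g = L g *m L h.
Proof. by rewrite valM linear_partM. Qed.

Lemma ghw_diagonalizable : ghw Gamma ->
  exists2 P, P \in unitmx &
    exists s : G -> 'I_m.+1 -> bool, forall g, P *m L g = sign_mx R (s g) *m P.
Proof.
move=> [_ [f [[f' fK f'K] fM]]].
have fpiM (g h : G) : f (\pi_Q%qT (g * h)%g) = f (\pi_Q%qT g) + f (\pi_Q%qT h).
  by rewrite pi_quotient_mul -fM.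
have f1 : f (\pi_Q%qT (1%g : G)) = 0.
  by apply: (addrI (f (\pi_Q%qT (1%g : G)))); rewrite -fpiM mulg1 addr0.
have LC (g h : G) : L g *m L h = L h *m L g.
  rewrite -!linear_part_valM; apply/holonomy_eq; apply: (can_inj fK).
  by rewrite !fpiM addrC.
have L2 (g : G) : L g *m L g = 1%:M.
  rewrite -linear_part_valM -linear_part_val1; apply/holonomy_eq.
  apply: (can_inj fK); rewrite fpiM f1; apply/rowP => i; rewrite !mxE.
  by case: (f _ _ _) => -[|[|]] //= lt2; apply/val_inj.
pose As := [seq L (repr (f' w)) | w <- enum 'rV['Z_2]_m].
have LAs (g : G) : L g \in As.
  apply/mapP; exists (f (\pi_Q%qT g)); first by rewrite mem_enum.
  by apply/holonomy_eq; rewrite fK reprK.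
have [P Pu PA] : exists2 P, P \in unitmx & forall A, A \in As ->
    exists h : 'I_m.+1 -> bool, P *m A = sign_mx R h *m P.
  apply: involutions_codiagonalizable => [_ /mapP[w _ ->]|]; first exact: L2.
  by move=> _ _ /mapP[w _ ->] /mapP[x _ ->]; exact: LC.
have [s sP] := choice (fun g : G => PA _ (LAs g)).
by exists P => //; exists s.
Qed.

Section Coordinates.
Variables (P : 'M[R]_m.+1) (s : G -> 'I_m.+1 -> bool).
Hypotheses (Pu : P \in unitmx) (Ps : forall g, P *m L g = sign_mx R (s g) *m P).
Hypothesis Gghw : ghw Gamma.

Definition coord (g : G) i := (P *m trans_part (val g)) i 0.

Lemma sign_linear (g h : G) : s g = s h <-> L g = L h.
Proof.
split=> E; first by apply: (can_inj (mulKmx Pu)); rewrite !Ps E.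
by apply: (@sign_mx_inj R); apply: (can_inj (mulmxK Pu)); rewrite -!Ps E.
Qed.

Lemma signM (g h : G) i : s (g * h)%g i = s g i (+) s h i.
Proof.
have : sign_mx R (s (g * h)%g) = sign_mx R (fun i => s g i (+) s h i).
  apply: (can_inj (mulmxK Pu)).
  by rewrite -Ps linear_part_valM mulmxA Ps -mulmxA Ps mulmxA sign_mxM.
by move/sign_mx_inj ->.
Qed.

Lemma coordM (g h : G) i :
  coord (g * h)%g i = (-1) ^+ s g i * coord h i + coord g i.
Proof.
rewrite /coord valM trans_partM mulmxDr mulmxA Ps -mulmxA mxE.
by rewrite sign_mx_mul_col.
Qed.

Lemma sign1 : s 1%g = fun=> false.
Proof.
apply/funext => i; have := signM 1%g 1%g i.
by rewrite mulg1; case: (s _ _).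
Qed.

(** On each line [g] is either a reversal or the identity, so its square is
    trivial. *)
Lemma sign_free (g : G) :
  (forall i, s g i = false -> coord g i = 0) -> forall i, s g i = false.
Proof.
move=> g0; have gg : (g * g)%g = 1%g.
  apply/val_inj; apply: euclid_eq.
    by apply/sign_linear/funext => i; rewrite signM addbb sign1.
  apply: (can_inj (mulKmx Pu)); apply/colP => i.
  rewrite val1 [trans_part 1%g]/trans_part /= mulmx0 [RHS]mxE.
  rewrite -/(coord (g * g)%g i) coordM.
  have := g0 i; case: (s g i) => [_|->//]; last by rewrite mulr0 addr0.
  by rewrite expr1 mulN1r addNr.
have [[tf _ _] _] := Gghw.
have g1 : val g = 1%g.
  by apply: (tf _ 2) => //; [exact: valP | rewrite expgS expg1 -valM gg val1].
have -> : g = 1%g by apply/val_inj; rewrite val1.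
by rewrite sign1.
Qed.

(** Two opposite sign vectors are not both realized, because their product
    would be realized by a motion that reverses all the lines. So the 2 ^ m
    realized sign vectors and their opposites exhaust the 2 ^ m.+1 sign
    vectors. *)
Lemma sign_complete_ghw (e : 'I_m.+1 -> bool) : exists g,
  (forall i, s g i = e i) \/ (forall i, s g i = ~~ e i).
Proof.
have [_ [f [[f' fK f'K] fM]]] := Gghw.
pose F w := [ffun i => s (repr (f' w)) i].
have F_inj : injective F.
  move=> w x /ffunP wx; apply: (can_inj f'K).
  rewrite -(reprK (f' w)) -(reprK (f' x)); apply/holonomy_eq/sign_linear.
  by apply/funext => i; have := wx i; rewrite !ffunE.
pose N (e : {ffun 'I_m.+1 -> bool}) := [ffun i => ~~ e i].
have NK : involutive N by move=> d; apply/ffunP => i; rewrite !ffunE negbK.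
pose A := (F @: {: 'rV['Z_2]_m})%SET.
pose B := (N @: A)%SET.
have AB : (A :&: B)%SET = finset.set0.
  apply/setP => d; rewrite !inE; apply/negP => /andP[/imsetP[w _ dw]].
  move=> /imsetP[_ /imsetP[x _ ->] dx].
  have /sign_free/(_ ord0) : forall i,
      s (repr (f' w) * repr (f' x))%g i = false ->
      coord (repr (f' w) * repr (f' x))%g i = 0.
    move=> i; rewrite signM; have /ffunP/(_ i) := etrans (esym dw) dx.
    by rewrite !ffunE => ->; rewrite addNb addbb.
  rewrite signM; have /ffunP/(_ ord0) := etrans (esym dw) dx.
  by rewrite !ffunE => ->; rewrite addNb addbb.
have cA : #|A| = (2 ^ m)%N.
  by rewrite card_imset // card_mx card_ord mul1n.
have AU : (A :|: B)%SET = finset.setT.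
  apply/eqP; rewrite eqEcard finset.subsetT cardsU AB cards0 subn0.
  rewrite (card_imset _ (inv_inj NK)) cA addnn -mul2n -expnS cardsT.
  by rewrite card_ffun card_bool card_ord leqnn.
have : [ffun i => e i] \in (A :|: B)%SET by rewrite AU inE.
rewrite inE => /orP[/imsetP[w _ /ffunP ew]|].
  by exists (repr (f' w)); left => i; have := ew i; rewrite !ffunE.
move=> /imsetP[_ /imsetP[w _ ->] /ffunP ew].
by exists (repr (f' w)); right => i; have := ew i; rewrite !ffunE => ->; rewrite negbK.
Qed.

Let u i : 'cV[R]_m.+1 := col i (invmx P).

Lemma mul_axis i j : (P *m u i) j 0 = (j == i)%:R.
Proof. by rewrite /u colE mulmxA mulmxV // mul1mx mxE eqxx andbT. Qed.

Lemma mul_axisZ y i j : (P *m (y *: u i)) j 0 = y * (j == i)%:R.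
Proof. by rewrite -scalemxAr mxE mul_axis. Qed.

Lemma axis_translationE k x :
  axis_translation s coord k x <-> translation (x *: u k) \in Gamma.
Proof.
split=> [[g [gT gk g0]]|xG].
  suff -> : translation (x *: u k) = val g by exact: valP.
  apply: euclid_eq.
    transitivity (L 1%g); first by rewrite linear_part_val1.
    by apply/sign_linear/funext => i; rewrite sign1 gT.
  apply: (can_inj (mulKmx Pu)); apply/colP => j; rewrite mul_axisZ.
  have [->|jk] := eqVneq j k; first by rewrite mulr1 -gk.
  by rewrite mulr0 -(g0 j jk).
pose g : G := Subgroup xG.
exists g; split=> [i||j jk].
- have -> : s g = s 1%g by apply/sign_linear; rewrite linear_part_val1.
  by rewrite sign1.
- by rewrite /coord mul_axisZ eqxx mulr1.
- by rewrite /coord mul_axisZ (negbTE jk) mulr0.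
Qed.

Lemma cyclic_axes_ghw k : exists l, forall x,
  axis_translation s coord k x <-> exists z : int, x = l *~ z.
Proof.
have [[_ dG _] _] := Gghw.
have uk0 : u k != 0.
  apply/eqP => uk; have := mul_axis k k.
  by rewrite uk mulmx0 mxE eqxx => /esym/eqP; rewrite oner_eq0.
have [e e0 eP] := discrete_translations dG uk0.
apply: (discrete_cyclic e0) => [|x y /axis_translationE xG /axis_translationE yG|].
- apply/axis_translationE; rewrite scale0r.
  have -> : translation 0 = 1%g :> euclid R m.+1 by exact: euclid_eq.
  exact: gpred1.
- apply/axis_translationE; rewrite scalerBl translationD translationN.
  by apply: gpredM => //; rewrite gpredV.
- by move=> x /axis_translationE; exact: eP.
Qed.

(** The vector [c i] generates the intersection of the lattice with the i-th
    line. It may still vanish at this stage; that the [c i] are independent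
    only comes from comparing them with a basis of the lattice. *)
Lemma ghw_lattice : exists c : 'I_m.+1 -> 'cV[R]_m.+1,
  [/\ forall i, lattice Gamma (c i),
      forall v, lattice Gamma v -> exists z, v = zcomb c z &
      forall g i, L g *m c i = (-1) ^+ s g i *: c i].
Proof.
have [l lP] := choice cyclic_axes_ghw.
exists (fun i => l i *: u i); split=> [i|v vG|g i].
- by apply/axis_translationE/lP; exists 1; rewrite mulr1z.
- pose g : G := Subgroup vG.
  have gT : is_translation s g.
    by move=> i; rewrite -[RHS](congr1 (@^~ i) sign1); congr (_ i);
      apply/sign_linear; rewrite linear_part_val1.
  have /(_ _)/lP := translation_components signM coordM sign_free cyclic_axes_ghw
    sign_complete_ghw gT.
  move=> /choice[z zP]; exists (\col_i z i).
  rewrite /zcomb; under eq_bigr do rewrite mxE.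
  apply: (can_inj (mulKmx Pu)); apply/colP => j.
  have cE i : (P *m (l i *: u i *~ z i)) j 0 = l i *~ z i * (j == i)%:R.
    by rewrite -scaler_int scalerA mul_axisZ mulrzl.
  rewrite -[LHS]/(coord g j) zP mulmx_sumr summxE (bigD1 j) //= cE eqxx mulr1.
  by rewrite big1 ?addr0 // => i ij; rewrite cE eq_sym (negbTE ij) mulr0.
- apply: (can_inj (mulKmx Pu)); rewrite mulmxA Ps -mulmxA.
  apply/colP => j; rewrite sign_mx_mul_col scalerA !mul_axisZ.
  by have [->|_] := eqVneq j i; rewrite ?mulr0 // !mulr1.
Qed.

End Coordinates.

Lemma zcomb_mulmx (b c : 'I_m.+1 -> 'cV[R]_m.+1) (N : 'M[int]_m.+1) z :
  (forall i, c i = zcomb b (col i N)) -> zcomb c z = zcomb b (N *m z).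
Proof.
move=> cE; rewrite /zcomb; under eq_bigr do rewrite cE /zcomb mulrz_suml.
rewrite exchange_big; apply: eq_bigr => i _; rewrite mxE mulrz_sumr.
by apply: eq_bigr => j _; rewrite mxE mulrzA.
Qed.

Lemma zcombZ (c : 'I_m.+1 -> 'cV[R]_m.+1) (B : 'M[R]_m.+1)
    (h : 'I_m.+1 -> bool) z :
  (forall i, B *m c i = (-1) ^+ h i *: c i) ->
  B *m zcomb c z = zcomb c (sign_mx int h *m z).
Proof.
move=> Bc; rewrite mulmx_sumr; apply: eq_bigr => i _.
rewrite sign_mx_mul_col raddfMz /= Bc.
by case: (h i); rewrite ?scale1r ?mul1r // expr1 scaleN1r mulN1r mulrNz mulNrz.
Qed.

(** The square integral matrices [N] and [M] express the vectors spanning the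
    lattice through the basis [b] and conversely. Freeness of [b] gives [N *m
    M = 1%:M], so [N] is a change of basis. *)
Theorem ghw_holonomy_diagonal b (rho : holonomy Gamma -> 'M[int]_m.+1) :
  ghw Gamma -> lattice_basis Gamma b -> integral_holonomy_rep b rho ->
  exists2 S : {set 'I_m.+1}, odd #|S| & GLZ_conj (diagonal_group S) (range rho).
Proof.
move=> Gghw [bG b_inj b_surj] rhoP.
have [P Pu [s Ps]] := ghw_diagonalizable Gghw.
have [c [cG c_span cs]] := ghw_lattice Pu Ps Gghw.
have /choice[N' N'P] : forall i, exists z, c i = zcomb b z.
  by move=> i; have [z _ <-] := b_surj _ (cG i); exists z.
have /choice[M' M'P] : forall i, exists z, b i = zcomb c z.
  move=> i; apply: c_span; have -> : b i = zcomb b (delta_mx i 0).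
    rewrite /zcomb (bigD1 i) //= big1 ?addr0 ?mxE ?eqxx ?mulr1z // => j ji.
    by rewrite mxE (negbTE ji) mulr0z.
  exact: bG.
pose N : 'M[int]_m.+1 := \matrix_(i, j) N' j i 0.
pose M : 'M[int]_m.+1 := \matrix_(i, j) M' j i 0.
have NP z : zcomb c z = zcomb b (N *m z).
  apply: zcomb_mulmx => i; rewrite N'P; congr zcomb.
  by apply/colP => j; rewrite !mxE.
have MP z : zcomb b z = zcomb c (M *m z).
  apply: zcomb_mulmx => i; rewrite M'P; congr zcomb.
  by apply/colP => j; rewrite !mxE.
have b_injT : injective (zcomb b) by move=> y z; apply: b_inj; rewrite inE.
have eq_mulmx (A B : 'M[int]_m.+1) :
    (forall z : 'cV_m.+1, A *m z = B *m z) -> A = B.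
  move=> AB; apply/matrixP => i j; have /colP/(_ i) := AB (delta_mx j 0).
  by rewrite -!colE !mxE.
have NM : N *m M = 1%:M.
  by apply: eq_mulmx => z; apply: b_injT; rewrite -mulmxA -NP -MP mul1mx.
have MN : invmx N = M by exact: mulmx1_invmx.
have rhoE (g : G) : rho (\pi_Q%qT g) = N *m sign_mx int (s g) *m M.
  apply: eq_mulmx => z; apply: b_injT; apply: (@translation_inj R m.+1).
  rewrite -rhoP conj_translation MP (zcombZ _ (cs g)) NP.
  by rewrite !mulmxA.
have signM' := signM Pu Ps.
have [|||S oddS SP] := @index2_sign_group _ (fun e => exists g, s g = e).
- by move=> _ _ [g <-] [h <-]; exists (g * h)%g; apply/funext => i; rewrite signM'.
- move=> e; have [g [ge|ge]] := sign_complete_ghw Pu Ps Gghw e.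
    by left; exists g; apply/funext.
  by right; exists g; apply/funext.
- case=> g ge; have /(_ ord0) : forall i, s g i = false.
    by apply: (sign_free Pu Ps Gghw) => i; rewrite ge.
  by rewrite ge.
exists S => //; exists N; first by have [] := mulmx1_unit NM.
rewrite MN; apply/seteqP; split=> [_ [x _ <-]|_ [_ [e /SP[g <-] <-] <-]].
  exists (sign_mx int (s (repr x))); last by rewrite -rhoE reprK.
  by exists (s (repr x)) => //; apply/SP; exists (repr x).
by exists (\pi_Q%qT g) => //; rewrite rhoE.
Qed.

End Holonomy.

(** * Compactness in the Euclidean group *)

(** An ultrafilter converges to each of its cluster points. *)
Lemma ultra_compact_cvg T (U : topologicalType) (F : set_system T) (f : T -> U)
    (K : set U) : UltraFilter F -> compact K -> F (f @^-1` K) ->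
  exists p, K p /\ f @ F --> p.
Proof.
move=> FU Kc FK; have [p [Kp clp]] := Kc (f @ F) _ FK.
exists p; split=> // A pA; have [//|FnA] := in_ultra_setVsetC (f @^-1` A) FU.
by have [q [nAq]] := clp (~` A) A FnA pA.
Qed.

Section EuclidTopology.
Variables (R : realType) (n : nat).

Lemma linear_part_continuous i j :
  continuous (fun g : euclid R n => linear_part g i j).
Proof.
move=> g; apply: (@continuous_comp _ _ _ (@linear_part R n)
    (fun M : 'M[R]_n => M i j)).
  apply: (@continuous_comp _ _ _ (@euclid_val R n) fst).
    exact: initial_continuous.
  exact: cvg_fst.
exact: coord_continuous.
Qed.

Lemma trans_part_continuous i j :
  continuous (fun g : euclid R n => trans_part g i j).
Proof.
move=> g; apply: (@continuous_comp _ _ _ (@trans_part R n)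
    (fun M : 'cV[R]_n => M i j)).
  apply: (@continuous_comp _ _ _ (@euclid_val R n) snd).
    exact: initial_continuous.
  exact: cvg_snd.
exact: coord_continuous.
Qed.

Lemma linear_part_bound (g : euclid R n) i j : -1 <= linear_part g i j <= 1.
Proof.
suff : linear_part g i j ^+ 2 <= 1.
  by rewrite -ler_norml -[_ ^+ 2]ger0_norm ?sqr_ge0 // normrX expr_le1.
have /matrixP/(_ i i) := linear_partP g; rewrite !mxE eqxx mulr1n => <-.
rewrite (bigD1 j) //= mxE -expr2 lerDl; apply: sumr_ge0 => k _.
by rewrite mxE -expr2 sqr_ge0.
Qed.

Definition trans_box (c : R) : set (euclid R n) :=
  [set g | forall i, -c <= trans_part g i 0 <= c].

(** Orthogonal matrices have entries between -1 and 1, so along an ultrafilter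
    all the entries converge; the limit matrix is orthogonal because [B *m B^T
    = 1%:M] is preserved by limits. *)
Lemma trans_box_compact c : compact (trans_box c).
Proof.
rewrite compact_ultra => F FU FK.
have /choice[B' B'P] : forall ij : 'I_n * 'I_n, exists x : R, `[-1, 1] x /\
    (fun g => linear_part g ij.1 ij.2) @ F --> x.
  move=> [i j]; apply: ultra_compact_cvg (@segment_compact R (-1) 1) _.
  by apply: filterE => g /=; rewrite in_itv /= linear_part_bound.
have /choice[b' b'P] : forall i, exists x : R, `[-c, c] x /\
    (fun g => trans_part g i 0) @ F --> x.
  move=> i; apply: ultra_compact_cvg (@segment_compact R (-c) c) _.
  by apply: filterS FK => g gK /=; rewrite in_itv /=; exact: gK.
pose B : 'M[R]_n := \matrix_(i, j) B' (i, j).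
have BO : orthogonal_mx (B, \col_i b' i).1.
  apply/eqP/matrixP => i j /=; rewrite [LHS]mxE.
  have BF : (fun g => (1%:M : 'M[R]_n) i j) @ F --> \sum_k B i k * B^T k j.
    rewrite [X in X @ _](_ : _ = fun g =>
        \sum_k linear_part g i k * linear_part g j k).
      apply: cvg_big => [|k _]; first exact: add_continuous.
      rewrite !mxE; apply: cvgM; first exact: (B'P (i, k)).2.
      exact: (B'P (j, k)).2.
    apply/funext => g; rewrite -(linear_partP g) mxE.
    by apply: eq_bigr => k _; rewrite mxE.
  have F1 : (fun g => (1%:M : 'M[R]_n) i j) @ F --> (1%:M : 'M[R]_n) i j.
    exact: cvg_cst.
  exact: (cvg_unique (@norm_hausdorff _ R^o) BF F1).
exists (Euclid BO); split=> [i|/=].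
  by have := (b'P i).1; rewrite /= in_itv /trans_part /= mxE.
apply: (@cvg_euclid _ _ _ _ id) => i j.
  by rewrite /linear_part /= mxE; exact: (B'P (i, j)).2.
by rewrite ord1 /trans_part /= mxE; exact: (b'P i).2.
Qed.

End EuclidTopology.

(** * Generalized Hantzsche-Wendt groups built from a cyclic shift *)

Section HalfInteger.
Variable R : realType.

Definition half_integer (b : bool) (x : R) := x - b%:R / 2 \is a Num.int.

Lemma half_integerN b x : half_integer b x -> half_integer b (- x).
Proof.
rewrite /half_integer => bx.
have -> : - x - b%:R / 2 = - (x - b%:R / 2) - b%:R by field.
by apply: rpredB; rewrite ?rpredN ?natr_int.
Qed.

Lemma half_integerD b c x y :
  half_integer b x -> half_integer c y -> half_integer (b (+) c) (x + y).
Proof.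
rewrite /half_integer => bx cy.
have -> : x + y - (b (+) c)%:R / 2 =
    (x - b%:R / 2) + (y - c%:R / 2) + (b && c)%:R.
  by case: b {bx}; case: c {cy} => /=; rewrite ?mulr0n ?mulr1n; lra.
by apply: rpredD; [exact: rpredD | exact: natr_int].
Qed.

Lemma half_integer_sign b (c : bool) x :
  half_integer b x -> half_integer b ((-1) ^+ c * x).
Proof. by case: c; rewrite ?mul1r // expr1 mulN1r; exact: half_integerN. Qed.

Lemma half_integer0 : half_integer false 0.
Proof. by rewrite /half_integer mul0r subr0 int_num0. Qed.

Lemma half_integer_neq0 : ~ half_integer true 0.
Proof.
rewrite /half_integer sub0r => /intrP[z E].
have : (z + z)%:~R = (-1)%:~R :> R by rewrite intrD -E mulrN1z mulr1n; lra.
by move/intr_inj; lia.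
Qed.

Lemma half_integer_false x : half_integer false x = (x \is a Num.int).
Proof. by rewrite /half_integer mul0r subr0. Qed.

Lemma half_integer_dist b x y :
  half_integer b x -> half_integer b y -> `|x - y| < 1 -> x = y.
Proof.
move=> bx by_; have := half_integerD bx (half_integerN by_).
rewrite addbb half_integer_false => /intrP[z xy]; rewrite xy.
rewrite -intr_norm -[1]/(1%:~R) ltr_int => z1.
by apply/eqP; rewrite -subr_eq0 xy intr_eq0; lia.
Qed.

End HalfInteger.

Lemma ordS_ind n (Q : 'I_n -> Prop) (i : 'I_n) :
  Q i -> (forall j, Q j -> Q (ordS j)) -> forall j, Q j.
Proof.
move=> Qi QS j; pose k := (j + (n - i))%N.
suff <- : iter k (@ordS n) i = j by elim: k => //= k; exact: QS.
have iterE l : iter l (@ordS n) i = ((i + l) %% n)%N :> nat.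
  elim: l => [|l IH]; first by rewrite addn0 modn_small.
  by rewrite iterS /= IH -addn1 modnDml addn1 addnS.
apply/val_inj; rewrite /= iterE /k addnCA subnKC; last exact: ltnW.
by rewrite modnDr modn_small.
Qed.

(** Otherwise the value [false] would propagate from [i] along the whole
    cycle. *)
Lemma ordS_ascent n (h : 'I_n -> bool) i j : h i = false -> h j = true ->
  exists k, h k = false /\ h (ordS k) = true.
Proof.
move=> hi hj; apply: contrapT => nk.
have /(_ j) : forall j, h j = false; last by rewrite hj.
apply: (ordS_ind hi) => k hk; apply/negP => hSk; apply: nk.
by exists k; split=> //; apply/idP.
Qed.

Section CyclicGHW.
Variables (R : realType) (m : nat) (S : {set 'I_m.+1}).

Definition diag_signs (g : euclid R m.+1) : 'I_m.+1 -> bool :=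
  fun i => linear_part g i i == -1.

(** Over the sign vector [h] the translation parts run through the coset of
    Z^n containing half the cyclic shift of [h]. This is closed under products
    because an element of (1/2)Z and its opposite agree modulo Z, and the
    shift is additive. *)
Definition cyclic_motion : {pred euclid R m.+1} := fun g =>
  [&& linear_part g == sign_mx R (diag_signs g),
      ~~ sign_parity S (diag_signs g) &
      [forall i, half_integer (diag_signs g (ordS i)) (trans_part g i 0)]].

Lemma sign_mx_diag (h : 'I_m.+1 -> bool) i : (sign_mx R h i i == -1) = h i.
Proof.
rewrite !mxE eqxx mulr1n; case: (h i); rewrite ?eqxx // expr0.
by rewrite -subr_eq0 opprK -[1 + 1]/2%:R pnatr_eq0.
Qed.

Lemma diag_signsE g h : linear_part g = sign_mx R h -> diag_signs g = h.
Proof. by move=> gh; apply/funext => i; rewrite /diag_signs gh sign_mx_diag. Qed.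

Lemma cyclic_motionP (g : euclid R m.+1) : g \in cyclic_motion <->
  exists h, [/\ linear_part g = sign_mx R h, sign_parity S h = false &
    forall i, half_integer (h (ordS i)) (trans_part g i 0)].
Proof.
split=> [/and3P[/eqP gh /negbTE hS /forallP gt]|[h [gh hS gt]]].
  by exists (diag_signs g).
rewrite unfold_in /cyclic_motion (diag_signsE gh) gh eqxx hS /=; exact/forallP.
Qed.

Fact cyclic_motion_mul : mulg_closed cyclic_motion.
Proof.
move=> g k /cyclic_motionP[h [gh hS gt]] /cyclic_motionP[e [ke eS kt]].
apply/cyclic_motionP; exists (fun i => h i (+) e i); split=> [||i].
- by rewrite linear_partM gh ke sign_mxM.
- by rewrite sign_parityD hS eS.
- rewrite trans_partM mxE gh sign_mx_mul_col addbC.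
  by apply: half_integerD (gt i); exact: half_integer_sign.
Qed.

Fact cyclic_motion1 : 1%g \in cyclic_motion.
Proof.
apply/cyclic_motionP; exists (fun=> false); split=> [||i].
- by rewrite sign_mx_false.
- exact: big1.
- by rewrite /trans_part mxE; exact: half_integer0.
Qed.

Fact cyclic_motionV : invg_closed cyclic_motion.
Proof.
move=> g /cyclic_motionP[h [gh hS gt]]; apply/cyclic_motionP.
have ghT : (linear_part g)^T = sign_mx R h by rewrite gh /sign_mx tr_diag_mx.
exists h; split=> // i.
rewrite /trans_part /= -/(linear_part g) -/(trans_part g) ghT mxE.
rewrite sign_mx_mul_col; apply: half_integerN; exact: half_integer_sign.
Qed.

HB.instance Definition _ :=
  isMulClosed.Build (euclid R m.+1) cyclic_motion cyclic_motion_mul.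
HB.instance Definition _ :=
  isMul1Closed.Build (euclid R m.+1) cyclic_motion cyclic_motion1.
HB.instance Definition _ :=
  isInvClosed.Build (euclid R m.+1) cyclic_motion cyclic_motionV.

Definition cyclic_group : groupClosed (euclid R m.+1) := cyclic_motion.

Lemma translation_cyclic v :
  translation v \in cyclic_group <-> forall i, v i 0 \is a Num.int.
Proof.
split=> [/cyclic_motionP[h [hv hS vt]] i|vt].
  have h0 : h = fun=> false.
    by rewrite -(diag_signsE hv); apply: diag_signsE; rewrite sign_mx_false.
  by have := vt i; rewrite h0 half_integer_false.
apply/cyclic_motionP; exists (fun=> false); split=> [||i].
- by rewrite sign_mx_false.
- exact: big1.
- by rewrite half_integer_false.
Qed.

Lemma trans_part_expg (g : euclid R m.+1) h k i :
  linear_part g = sign_mx R h -> h i = false ->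
  trans_part (g ^+ k)%g i 0 = trans_part g i 0 *+ k.
Proof.
move=> gh hi; elim: k => [|k IH]; first by rewrite expg0 [LHS]mxE.
by rewrite expgS trans_partM mxE gh sign_mx_mul_col hi mul1r IH mulrSr.
Qed.

Hypothesis oddS : odd #|S|.

(** If a power of [g] is trivial, then [g] has no displacement along the lines
    that it preserves. At an ascent of [h] this displacement is half an odd
    integer, so [h] is constant, and oddness of [S] leaves only the constant
    [false]. *)
Lemma cyclic_torsion_free : torsion_free cyclic_group.
Proof.
move=> g k /cyclic_motionP[h [gh hS gt]] k0 gk1.
have t0 i : h i = false -> trans_part g i 0 = 0.
  move=> hi; have := trans_part_expg k gh hi; rewrite gk1 [LHS]mxE => /esym/eqP.
  by rewrite mulrn_eq0 eqn0Ngt k0 => /eqP.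
have [i hi] : exists i, h i = false.
  apply: contrapT => nh; move: hS; rewrite (_ : h = fun=> true).
    by rewrite sign_parity_true oddS.
  by apply/funext => i; apply: contrapT => hi; apply: nh; exists i; apply/negP.
have h0 j : h j = false.
  apply/negP => hj; have [l [hl hSl]] := ordS_ascent hi hj.
  by have := gt l; rewrite hSl t0 //; exact: half_integer_neq0.
have {}h0 : h = fun=> false by apply/funext.
apply: euclid_eq; first by rewrite gh h0 sign_mx_false.
by apply/colP => j; rewrite t0 ?h0 // [RHS]mxE.
Qed.

(** Motions with close entries have the same signs, and then their translation
    parts differ by integers. *)
Lemma cyclic_discrete : discrete_subgroup cyclic_group.
Proof.
move=> g gG; split; first by rewrite inE.
pose V := [set k : euclid R m.+1 |
  (forall i, `|linear_part g i i - linear_part k i i| < 1)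
  /\ (forall i, `|trans_part g i 0 - trans_part k i 0| < 1)].
have FF : Filter (nbhs g) by exact: nbhs_filter.
exists V.
  have nearL : \forall k \near g, forall i,
      `|linear_part g i i - linear_part k i i| < 1.
    apply: (@filter_forall _ _ _ _ FF) => i.
    by have /cvgrPdist_lt := @linear_part_continuous R m.+1 i i g; apply.
  have neart : \forall k \near g, forall i,
      `|trans_part g i 0 - trans_part k i 0| < 1.
    apply: (@filter_forall _ _ _ _ FF) => i.
    by have /cvgrPdist_lt := @trans_part_continuous R m.+1 i 0 g; apply.
  by apply: filterS2 nearL neart.
apply/seteqP; split=> [k [[kL kt] kG]|_ ->]; last first.
  by split=> //; split=> i; rewrite subrr normr0.
move: gG kG => /cyclic_motionP[h [gh _ gt]] /cyclic_motionP[e [ke _ et]].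
have he : e = h.
  apply/funext => i; have := kL i; rewrite gh ke !mxE eqxx !mulr1n.
  by case: (h i); case: (e i) => //; rewrite ltr_norml; lra.
rewrite he in ke et; apply: euclid_eq; first by rewrite gh ke.
by apply/colP => i; apply: half_integer_dist (et i) (gt i) _; rewrite distrC.
Qed.

(** Composing with an integral translation brings the translation part of any
    motion into the image of the unit cube under an orthogonal matrix, where
    all the coordinates are bounded by the dimension. *)
Lemma cyclic_cocompact : cocompact cyclic_group.
Proof.
have box : compact (trans_box m.+1%:R : set (euclid R m.+1)).
  exact: trans_box_compact.
pose pi : euclid R m.+1 -> quotient_topology (cosets cyclic_group) :=
  \pi_(cosets cyclic_group)%qT.
rewrite /cocompact [X in compact X](_ : _ = pi @` trans_box m.+1%:R).
  apply: continuous_compact box.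
  by apply: continuous_subspaceT; exact: pi_continuous.
apply/seteqP; split=> // x _.
pose g := repr (x : cosets cyclic_group).
pose w := (linear_part g)^T *m trans_part g.
pose v : 'cV[R]_m.+1 := \col_i - (Num.floor (w i 0))%:~R.
have vG : translation v \in cyclic_group.
  by apply/translation_cyclic => i; rewrite mxE rpredN intr_int.
exists (g * translation v)%g; last first.
  rewrite -[RHS](reprK (x : cosets cyclic_group)); apply/esym/eqmodP.
  by rewrite /= /coset_rel mulKg.
move=> i; rewrite trans_partM -[trans_part g]mul1mx -(linear_partP g).
rewrite -mulmxA -mulmxDr.
rewrite -ler_norml mxE; apply: le_trans (ler_norm_sum _ _ _) _.
apply: le_trans (_ : _ <= \sum_(k < m.+1) 1) _; last first.
  by rewrite sumr_const card_ord.
apply: ler_sum => k _; rewrite normrM mulr_ile1 //.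
  by rewrite ler_norml linear_part_bound.
rewrite !mxE -/(w k 0) ger0_norm; last by rewrite addrC subr_ge0 floor_le.
by rewrite addrC lerBlDr addrC -[1]/(1%:~R) -intrD ltW // floorD1_gt.
Qed.

Lemma cyclic_bieberbach : bieberbach cyclic_group.
Proof.
by split; [exact: cyclic_torsion_free|exact: cyclic_discrete|exact: cyclic_cocompact].
Qed.

End CyclicGHW.

Section CyclicHolonomy.
Variables (R : realType) (m : nat) (S : {set 'I_m.+1}).
Hypothesis oddS : odd #|S|.
Local Notation Gamma := (cyclic_group R S).
Local Notation G := (subgroup Gamma).
Local Notation Q := (quotient_group (@translations R m.+1 Gamma)).

Definition holonomy_signs (x : holonomy Gamma) := diag_signs (val (repr x)).

Lemma subgroup_signs (g : G) :
  linear_part (val g) = sign_mx R (diag_signs (val g)) /\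
  sign_parity S (diag_signs (val g)) = false.
Proof.
by have /cyclic_motionP[h [gh hS _]] := valP g; rewrite (diag_signsE gh).
Qed.

Lemma holonomy_signs_pi (g : G) :
  holonomy_signs (\pi_Q%qT g) = diag_signs (val g).
Proof.
rewrite /holonomy_signs /diag_signs; apply/funext => i.
by have /holonomy_eq -> := reprK (\pi_Q%qT g).
Qed.

Lemma holonomy_signs_parity x : sign_parity S (holonomy_signs x) = false.
Proof. exact: (subgroup_signs _).2. Qed.

Lemma holonomy_signs_inj : injective holonomy_signs.
Proof.
move=> x y xy; rewrite -(reprK x) -(reprK y); apply/holonomy_eq.
by rewrite !(subgroup_signs _).1 -/(holonomy_signs x) xy.
Qed.

Lemma holonomy_signsM x y :
  holonomy_signs (x * y)%g = fun i => holonomy_signs x i (+) holonomy_signs y i.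
Proof.
have -> : (x * y)%g = \pi_Q%qT (repr x * repr y)%g.
  by rewrite pi_quotient_mul !reprK.
rewrite holonomy_signs_pi; apply: diag_signsE.
by rewrite valM linear_partM !(subgroup_signs _).1 sign_mxM.
Qed.

Lemma exists_holonomy_signs h : sign_parity S h = false ->
  exists x, holonomy_signs x = h.
Proof.
move=> hS.
have hO : orthogonal_mx (sign_mx R h, \col_i ((h (ordS i))%:R / 2 : R)).1.
  rewrite /orthogonal_mx /= /sign_mx tr_diag_mx -/(sign_mx R h) sign_mxM.
  apply/eqP; rewrite -sign_mx_false; congr sign_mx.
  by apply/funext => i; rewrite addbb.
have hG : Euclid hO \in Gamma.
  apply/cyclic_motionP; exists h; split=> // i.
  by rewrite /trans_part mxE /half_integer subrr int_num0.
exists (\pi_Q%qT (Subgroup hG)); rewrite holonomy_signs_pi.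
exact: diag_signsE.
Qed.

(** A coordinate [i0] of [S] is recovered from the other ones by the parity
    condition, so forgetting it identifies the holonomy with the vectors over
    Z/2 having one entry less. *)
Lemma cyclic_ghw : ghw Gamma.
Proof.
split; first exact: cyclic_bieberbach.
have [i0 i0S] : exists i0, i0 \in S.
  by apply/set0Pn; apply: contraTneq oddS => ->; rewrite cards0.
pose f x : 'rV['Z_2]_m := \row_j (holonomy_signs x (lift i0 j))%:R.
have Z2_inj (b c : bool) : b%:R = c%:R :> 'Z_2 -> b = c by case: b; case: c.
exists f; split; last first.
  move=> x y; apply/rowP => j; rewrite !mxE holonomy_signsM.
  by case: (holonomy_signs x _); case: (holonomy_signs y _); apply/val_inj.
rewrite -setTT_bijective; split=> // [x y _ _ /rowP fxy|w _].
  apply: holonomy_signs_inj; apply/funext => i; apply: contrapT => xyi.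
  have off j : holonomy_signs x (lift i0 j) = holonomy_signs y (lift i0 j).
    by apply: Z2_inj; have := fxy j; rewrite !mxE.
  have [j ij|ii0] := unliftP i0 i; first by apply: xyi; rewrite ij off.
  have : sign_parity S (pred1 i0) = false.
    rewrite -(addbb false) -{1}(holonomy_signs_parity x) -(holonomy_signs_parity y).
    rewrite -sign_parityD; apply: eq_sign_parity => k /=.
    have [j ->|->] := unliftP i0 k.
      by rewrite off addbb eq_sym (negbTE (neq_lift _ _)).
    rewrite ii0 in xyi; rewrite eqxx.
    by case: (holonomy_signs x i0) xyi; case: (holonomy_signs y i0).
  by rewrite sign_parity_flip i0S.
pose e b i := if unlift i0 i is Some j then w 0 j != 0 else b.
(* The parity over [S] is corrected by the value at [i0]. *)
have [b eS] : exists b, sign_parity S (e b) = false.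
  case E: (sign_parity S (e false)); last by exists false.
  exists true; rewrite (@eq_sign_parity _ _ _ (fun i => e false i (+) (i == i0))).
    by rewrite sign_parityD E (sign_parity_flip S i0) i0S.
  move=> i; rewrite /e; have [j ->|->] := unliftP i0 i.
    by rewrite [_ == i0]eq_sym (negbTE (neq_lift _ _)) addbF.
  by rewrite eqxx.
have [x xe] := exists_holonomy_signs eS.
exists x => //; apply/rowP => j; rewrite mxE xe /e liftK.
by case: (w 0 j) => -[|[|]] // lt; apply/val_inj.
Qed.

Definition std_basis (i : 'I_m.+1) : 'cV[R]_m.+1 := delta_mx i 0.

Lemma zcomb_std z : zcomb std_basis z = map_mx intr z.
Proof.
apply/colP => i; rewrite summxE (bigD1 i) //= big1 ?addr0 => [|j ji].
  by rewrite -scaler_int !mxE !eqxx mulr1.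
by rewrite -scaler_int !mxE eq_sym (negbTE ji) mulr0.
Qed.

Lemma cyclic_lattice_basis : lattice_basis Gamma std_basis.
Proof.
split=> [z _|y z _ _|v /translation_cyclic vZ].
- by apply/translation_cyclic => i; rewrite zcomb_std mxE intr_int.
- rewrite !zcomb_std => /colP yz; apply/colP => i; have := yz i.
  by rewrite !mxE => /intr_inj.
- have /choice[z zP] : forall i, exists z : int, v i 0 = z%:~R.
    by move=> i; apply/intrP.
  by exists (\col_i z i) => //; rewrite zcomb_std; apply/colP => i; rewrite !mxE.
Qed.

Theorem diagonal_group_realized : ghw_holonomy_image R m.+1 (diagonal_group S).
Proof.
exists Gamma; split; first exact: cyclic_ghw.
exists std_basis, (fun x => sign_mx int (holonomy_signs x)); split.
- exact: cyclic_lattice_basis.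
- move=> g z; rewrite conj_translation holonomy_signs_pi.
  congr translation; apply: zcombZ => i; rewrite (subgroup_signs _).1.
  apply/colP => j; rewrite sign_mx_mul_col !mxE.
  by case: eqP => [->|_]; rewrite ?mulr0.
- apply/seteqP; split=> [_ [h hS <-]|_ [x _ <-]].
    by have [x <-] := exists_holonomy_signs hS; exists x.
  by exists (holonomy_signs x) => //; exact: holonomy_signs_parity.
Qed.

End CyclicHolonomy.

(** * Counting the classes *)

Lemma initial_segment_card m k :
  (k <= m)%N -> #|[set i : 'I_m | (i < k)%N]%SET| = k.
Proof.
move=> km; rewrite -sum1dep_card -(big_ord_widen_cond _ xpredT (fun=> 1%N)) //=.
by rewrite sum1_card card_ord.
Qed.
Local Open Scope card_scope.

Lemma card_ghw_holonomy_classes (R : realType) m :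
  ghw_holonomy_classes R m.+1 #= `I_m./2.+1.
Proof.
have oddE k : (k < m./2.+1)%N = (2 * k + 1 <= m.+1)%N by lia.
pose seg k := [set i : 'I_m.+1 | (i < 2 * k + 1)%N]%SET.
have segE k : (k < m./2.+1)%N -> #|seg k| = (2 * k + 1)%N.
  by rewrite oddE => /initial_segment_card.
pose cls k := [set K | GLZ_conj (diagonal_group (seg k)) K].
have -> : ghw_holonomy_classes R m.+1 = cls @` `I_m./2.+1.
  apply/seteqP; split=> [|_ [k km <-]].
    move=> _ [H [Gamma [Gghw [b [rho [bG rhoP ->]]]]] <-].
    have [S oddS SH] := ghw_holonomy_diagonal Gghw bG rhoP.
    have Sk : (#|S| = 2 * (#|S|./2) + 1)%N by lia.
    have km : (#|S|./2 < m./2.+1)%N.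
      by rewrite oddE -Sk -[leqRHS]card_ord max_card.
    exists (#|S|./2) => //; apply: GLZ_class_eq; apply: GLZ_conj_trans SH.
    by apply: diagonal_group_perm; rewrite segE.
  exists (diagonal_group (seg k)) => //; apply: diagonal_group_realized.
  by rewrite segE //; lia.
apply: inj_card_eq => j k; rewrite !inE => jm km jk.
have : cls k (diagonal_group (seg k)) by exact: GLZ_conj_refl.
by rewrite -jk => /diagonal_group_card; rewrite !segE //; lia.
Qed.

Unset Implicit Arguments.
Local Close Scope card_scope.
Local Close Scope classical_set_scope.
Local Close Scope ring_scope.

Theorem theorem5p3 (R : realType) (n : nat) (n_gt0 : 0 < n) :
  (ghw_holonomy_classes R n #=
     `I_(if odd n then (n + 1) %/ 2 else n %/ 2))%card.
Proof.
case: n n_gt0 => // m _.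
have -> : (if odd m.+1 then (m.+1 + 1) %/ 2 else m.+1 %/ 2) = m./2.+1.
  by case: ifP; lia.
exact: card_ghw_holonomy_classes.
Qed.
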